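(* For any positive integers $n$ and $k$, the following identity of formal power series in $q$ holds: $$q^{N}\sum_{\pi\in \mathrm{RPP}(\delta_{n+2k}/\delta_n)}q^{|\pi|}=\det\left[\widetilde{E}^{*}_{2(n+i+j)-3}(q)\right]_{i,j=1}^{k},\qquad\text{where } N=\frac{k(k-1)(6n+8k-1)}{6}.$$
   Context: $\delta_n=(n-1,n-2,\ldots,1)$ is the staircase shape partition. For partitions $\mu\subseteq\lambda$, the skew diagram $\lambda/\mu$ is the set of squares of the (left-justified) Young diagram of $\lambda$ not in that of $\mu$. A reverse plane partition $\pi$ of shape $\lambda/\mu$ is an assignment of nonnegative integers to the squares of $\lambda/\mu$ that is weakly increasing along each row (left to right) and along each column (top to bottom); $\mathrm{RPP}(\lambda/\mu)$ is the set of these, and $|\pi|$ is the sum of the entries of $\pi$. For a permutation $\tau=\tau_1\cdots\tau_N$ of $\{1,\dots,N\}$, $\mathrm{maj}(\tau)=\sum_{i:\,\tau_i>\tau_{i+1}} i$. Let $\mathrm{Ralt}_{2m+1}$ be the set of reverse alternating permutations of $\{1,\dots,2m+1\}$, i.e. permutations with $\sigma_1<\sigma_2>\sigma_3<\sigma_4>\cdots$. Let $\kappa=1\,3\,2\,5\,4\cdots(2m+1)(2m)$ (so $\kappa\in\mathrm{Ralt}_{2m+1}$). For a positive integer $m$ set $$E^{*}_{2m+1}(q)=\sum_{\sigma\in \mathrm{Ralt}_{2m+1}} q^{\mathrm{maj}(\sigma^{-1}\kappa)},\qquad \widetilde{E}^{*}_{2m+1}(q)=\frac{E^{*}_{2m+1}(q)}{(1-q)(1-q^2)\cdots(1-q^{2m+1})},$$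 where, by convention, $\sigma^{-1}\kappa$ denotes the permutation obtained from the word of $\sigma^{-1}$ by interchanging the values $2i$ and $2i+1$ for each $1\le i\le m$. *)

(* Defs.v *)
From HB Require Import structures.
From mathcomp Require Import all_boot all_order all_algebra all_fingroup.
From mathcomp Require Import finmap zify.
From mathcomp Require Import boolp classical_sets functions cardinality.

Set Implicit Arguments.
Unset Strict Implicit.
Unset Printing Implicit Defensive.

Import GRing.Theory.
Local Open Scope ring_scope.

(** * Formal power series in one variable q *)

Record fps (R : Type) := Fps { fcoef : nat -> R }.

Lemma fpsP (R : Type) (f g : fps R) : (forall n, fcoef f n = fcoef g n) -> f = g.
Proof. by case: f g => [f] [g] /= /funext ->. Qed.

HB.instance Definition _ (R : Type) := gen_eqMixin (fps R).
HB.instance Definition _ (R : Type) := gen_choiceMixin (fps R).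

Definition fps_zero (R : zmodType) : fps R := Fps (fun=> 0).
Definition fps_opp (R : zmodType) (f : fps R) : fps R :=
  Fps (fun n => - fcoef f n).
Definition fps_add (R : zmodType) (f g : fps R) : fps R :=
  Fps (fun n => fcoef f n + fcoef g n).

Lemma fps_addA (R : zmodType) : associative (@fps_add R).
Proof. by move=> f g h; apply: fpsP => n /=; rewrite addrA. Qed.
Lemma fps_addC (R : zmodType) : commutative (@fps_add R).
Proof. by move=> f g; apply: fpsP => n /=; rewrite addrC. Qed.
Lemma fps_add0 (R : zmodType) : left_id (@fps_zero R) (@fps_add R).
Proof. by move=> f; apply: fpsP => n /=; rewrite add0r. Qed.
Lemma fps_addN (R : zmodType) :
  left_inverse (@fps_zero R) (@fps_opp R) (@fps_add R).
Proof. by move=> f; apply: fpsP => n /=; rewrite addNr. Qed.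

HB.instance Definition _ (R : zmodType) := GRing.isZmodule.Build (fps R)
  (@fps_addA R) (@fps_addC R) (@fps_add0 R) (@fps_addN R).

Definition fps_one (R : comNzRingType) : fps R := Fps (fun n => (n == 0%N)%:R).
Definition fps_mul (R : comNzRingType) (f g : fps R) : fps R :=
  Fps (fun n => \sum_(i < n.+1) fcoef f i * fcoef g (n - i)%N).

Definition fps_trunc (R : comNzRingType) (m : nat) (f : fps R) : {poly R} :=
  \poly_(i < m) fcoef f i.

Lemma fps_mul_trunc (R : comNzRingType) (f g : fps R) (m n : nat) :
  (n < m)%N -> fcoef (fps_mul f g) n = (fps_trunc m f * fps_trunc m g)`_n.
Proof.
move=> ltnm; rewrite coefM; apply: eq_bigr => i _; rewrite !coef_poly.
rewrite (leq_ltn_trans (leq_subr _ _) ltnm).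
by rewrite (leq_ltn_trans _ ltnm) // -ltnS.
Qed.

Lemma fps_mulA (R : comNzRingType) : associative (@fps_mul R).
Proof.
move=> f g h; apply: fpsP => n.
transitivity ((fps_trunc n.+1 f * (fps_trunc n.+1 g * fps_trunc n.+1 h))`_n).
  rewrite (fps_mul_trunc _ _ (ltnSn n)) !coefM; apply: eq_bigr => i _.
  by rewrite !coef_poly ltn_ord ltnS leq_subr (@fps_mul_trunc _ _ _ n.+1)
     ?ltnS ?leq_subr.
rewrite mulrA (fps_mul_trunc _ _ (ltnSn n)) coefM [RHS]coefM.
apply: eq_bigr => i _.
by rewrite !coef_poly ltn_ord ltnS leq_subr (@fps_mul_trunc _ _ _ n.+1).
Qed.

Lemma fps_mulC (R : comNzRingType) : commutative (@fps_mul R).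
Proof.
by move=> f g; apply: fpsP => n; rewrite !(fps_mul_trunc _ _ (ltnSn n)) mulrC.
Qed.

Lemma fps_mul1 (R : comNzRingType) : left_id (@fps_one R) (@fps_mul R).
Proof.
move=> f; apply: fpsP => n /=; rewrite big_ord_recl /= mul1r subn0 big1 ?addr0 //.
by move=> i _; rewrite mul0r.
Qed.

Lemma fps_mulDl (R : comNzRingType) :
  left_distributive (@fps_mul R) (@GRing.add (fps R)).
Proof.
move=> f g h; apply: fpsP => n /=; rewrite -big_split /=.
by apply: eq_bigr => i _; rewrite mulrDl.
Qed.

Lemma fps_oner_neq0 (R : comNzRingType) : fps_one R != 0.
Proof.
by apply/eqP => /(congr1 (fun f => fcoef f 0)) /= /eqP; rewrite oner_eq0.
Qed.

HB.instance Definition _ (R : comNzRingType) :=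
  GRing.Zmodule_isComNzRing.Build (fps R)
  (@fps_mulA R) (@fps_mulC R) (@fps_mul1 R) (@fps_mulDl R) (@fps_oner_neq0 R).

Definition fps_unit (R : comNzRingType) : {pred fps R} :=
  fun f => `[< exists g : fps R, g * f = 1 >].
Definition fps_inv (R : comNzRingType) (f : fps R) : fps R :=
  xget f [set g : fps R | g * f = 1]%classic.

Lemma fps_mulVf (R : comNzRingType) :
  {in @fps_unit R, left_inverse 1 (@fps_inv R) *%R}.
Proof. by move=> f /asboolP ex; apply: (xgetPex f ex). Qed.
Lemma fps_unitP (R : comNzRingType) (f g : fps R) : g * f = 1 -> fps_unit f.
Proof. by move=> gf1; apply/asboolP; exists g. Qed.
Lemma fps_inv_out (R : comNzRingType) :
  {in [predC @fps_unit R], @fps_inv R =1 id}.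
Proof.
by move=> f /asboolP nf; rewrite /fps_inv xgetPN // => g gf; apply: nf; exists g.
Qed.

HB.instance Definition _ (R : comNzRingType) :=
  GRing.ComNzRing_hasMulInverse.Build (fps R)
  (@fps_mulVf R) (@fps_unitP R) (@fps_inv_out R).

Definition fpsX (R : comNzRingType) : fps R := Fps (fun n => (n == 1%N)%:R).

Notation "'q" := (@fpsX int) (at level 0) : ring_scope.

Lemma coef_fpsXn (R : comNzRingType) (i n : nat) :
  fcoef (fpsX R ^+ i) n = (n == i)%:R.
Proof.
elim: i n => [|i IH] n //; rewrite exprS.
have [-> | n0] := posnP n.
  by rewrite /= big_ord_recl big_ord0 /= mul0r addr0.
case: n n0 => // n _ /=; rewrite big_ord_recl /= mul0r add0r.
rewrite big_ord_recl /= mul1r IH big1 ?addr0 ?subSS ?subn0 //.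
by move=> j _; rewrite mul0r.
Qed.

(* The denominators below are therefore invertible power series. *)
Lemma fps_unit_1subXn (i : nat) : (0 < i)%N -> 1 - 'q ^+ i \is a GRing.unit.
Proof.
move=> i0; apply: (@fps_unitP _ _ (Fps (fun n => (i %| n)%:R))).
rewrite mulrBr mulr1 mulrC; apply: fpsP => n /=.
have -> : \sum_(j < n.+1) fcoef ('q ^+ i) j * ((i %| n - j)%:R : int)
          = ((i <= n)%N && (i %| n - i)%N)%:R.
  case: (leqP i n) => [lein|ltni] /=.
    rewrite (bigD1 (Ordinal (lein : (i < n.+1)%N))) //= coef_fpsXn eqxx mul1r.
    rewrite big1 ?addr0 // => j; rewrite -val_eqE /= => /negPf ji.
    by rewrite coef_fpsXn ji mul0r.
  rewrite big1 // => j _; rewrite coef_fpsXn.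
  by rewrite ltn_eqF ?mul0r // (leq_trans (ltn_ord j)).
have [->|n0] := posnP n; first by rewrite dvdn0 leqNgt i0 subr0.
case: leqP => [lein|ltni] /=; last by rewrite gtnNdvd // subr0.
by rewrite dvdn_subl // subrr.
Qed.

(* The formal sum of 'q ^+ w x over all x in A: its coefficient of index n
   counts the x in A of weight n. It is meaningful when each weight is taken
   finitely often on A ([fset_set] is empty on infinite sets). *)
Definition fps_gen (T : choiceType) (A : set T) (w : T -> nat) : fps int :=
  Fps (fun n => (#|` fset_set [set x | A x /\ w x = n]%classic|)%:R).

(** * Skew diagrams and reverse plane partitions *)

Definition staircase (n : nat) : seq nat := [seq (n - i)%N | i <- iota 1 n.-1].

(* Squares are (row, column), counted from 0. The first part of [la], its
   largest one, bounds the columns. *)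
Definition in_skew (la mu : seq nat)
    (c : 'I_(size la) * 'I_(head 0%N la)) : bool :=
  (nth 0%N mu c.1 <= c.2 < nth 0%N la c.1)%N.

Notation skew la mu :=
  {c : 'I_(size la) * 'I_(head 0%N la) | in_skew mu c} (only parsing).

Definition row_of (la mu : seq nat) (c : skew la mu) : nat := (val c).1.
Definition col_of (la mu : seq nat) (c : skew la mu) : nat := (val c).2.

Definition is_rpp (la mu : seq nat) (p : {ffun skew la mu -> nat}) : Prop :=
  (forall c d, row_of c = row_of d -> (col_of c <= col_of d)%N -> (p c <= p d)%N)
  /\
  (forall c d, col_of c = col_of d -> (row_of c <= row_of d)%N -> (p c <= p d)%N).

Definition RPP (la mu : seq nat) : set {ffun skew la mu -> nat} :=
  [set p | is_rpp p]%classic.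

Definition rpp_size (la mu : seq nat) (p : {ffun skew la mu -> nat}) : nat :=
  (\sum_c p c)%N.

Lemma finite_RPP_size (la mu : seq nat) (n : nat) :
  finite_set [set p | RPP p /\ @rpp_size la mu p = n]%classic.
Proof.
pose f (g : {ffun skew la mu -> 'I_n.+1}) : {ffun skew la mu -> nat} :=
  [ffun c => val (g c)].
apply: (@sub_finite_set _ _ (f @` setT)%classic); last first.
  exact: finite_image.
move=> p [_ pn]; exists [ffun c => inord (p c)] => //.
apply/ffunP => c; rewrite !ffunE /= inordK // ltnS -pn.
by rewrite /rpp_size (bigD1 c) //= leq_addr.
Qed.

(** * Permutations and q-Euler numbers *)

(* Positions and values are counted from 0, whence the weight i.+1. *)
Definition maj (N : nat) (t : 'S_N) : nat :=
  (\sum_(i < N) \sum_(j < N | (val j == i.+1) && (t j < t i)) i.+1)%N.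

Definition ralt (N : nat) (s : 'S_N) : bool :=
  [forall i : 'I_N, forall j : 'I_N, (val j == i.+1) ==>
     (if odd i then s j < s i else s i < s j)%N].

(* 1 3 2 5 4 ... in one-line notation, counted from 0; for even N, which is not
   used, the last point is fixed. *)
Definition kappa_fun (N : nat) (i : 'I_N) : 'I_N :=
  insubd i (if odd i then i.+1 else i.-1).

Lemma kappa_funK (N : nat) : involutive (@kappa_fun N).
Proof.
move=> i; apply: val_inj; rewrite /kappa_fun !val_insubd.
case: i => [[|i] lti] /=; first by rewrite !lti.
case: (boolP (odd i)) => /= [oddi|evi].
  by rewrite (ltnW lti) /= oddi lti.
case: (ltnP i.+2 N) => [_|leN] /=; rewrite ?negbK.
  by rewrite (negbTE evi) lti.
by rewrite evi ltnNge leN.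
Qed.

Definition kappa (N : nat) : 'S_N := perm (inv_inj (@kappa_funK N)).

(* Permutations compose from left to right, so s^-1 * kappa applies [kappa] to
   the values of s^-1. *)
Definition Estar (N : nat) : fps int :=
  \sum_(s : 'S_N | ralt s) 'q ^+ maj (s^-1 * kappa N)%g.

Definition tEstar (N : nat) : fps int :=
  Estar N / \prod_(1 <= i < N.+1) (1 - 'q ^+ i).

(* The exponent of q in the main identity is an exact quotient. *)
Lemma dvdn_exponent (n k : nat) :
  (6 %| k * (k - 1) * (6 * n + 8 * k - 1))%N.
Proof.
case: k => // k; rewrite subn1 /=.
have -> : (6 * n + 8 * k.+1 - 1 = 6 * n + 8 * k + 7)%N by lia.
elim: k => [|k IH]; first by rewrite muln0 mul0n.
have -> : (k.+2 * k.+1 * (6 * n + 8 * k.+1 + 7)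
  = k.+1 * k * (6 * n + 8 * k + 7) + 6 * (k.+1 * (2 * n + 4 * k + 5)))%N by lia.
by rewrite dvdn_addr // dvdn_mulr.
Qed.

(* Main.v *)
From mathcomp Require Import all_boot all_order all_algebra all_fingroup.
From mathcomp Require Import finmap zify ring.
From mathcomp Require Import boolp classical_sets cardinality.
Require Import Defs.

(** Cut a reverse plane partition of the thick staircase strip along its
diagonals j - i = constant. Adding its index r to the entry of index r turns
each slice into a strictly increasing k-tuple (missing cells of the two
triangular ends are read as entries 0, so that they become the value r), and
monotonicity along rows and columns becomes interlacing of consecutive slices,
alternately upwards and downwards. The strip is thus a closed walk among
strictly increasing k-tuples that starts and ends at (0, 1, ..., k-1)
([walk_of_rppP], [rpp_of_walkP], [card_rpp]); the triangular shape of the ends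
need not be imposed, because interlacing with the end points forces it
([walk_val_forced_left]).

Let A be the matrix with entries [b <= a] and D = diag(q^a). A minor of A whose
rows and columns are increasing tuples is the indicator of interlacing, so the
generating function of the walks is a single k by k minor of
(A^T D A D)^m (A^T D A), at the rows and columns 0, ..., k-1
([det_zigzag_walk]). The inverse of P = A^T D A D is tridiagonal, so the row of
index i of a power of P is a combination of the rows of index 0 of that power
and lower powers, with coefficients given by a three-term recurrence
([erow_recS], [erow_hpol]). This triangular change of basis turns the minor
into the Hankel determinant of the (0, 0) entries of P^m A^T D A, up to a power
of q ([det_hankel]).

The (0, 0) entry is the case k = 1 of the walks: it counts the zigzags
a_0 >= a_1 <= a_2 >= ... <= a_2m ([zigzag_gen_mx]). By the theory of
P-partitions, with the labelling of positions by kappa, which is natural for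
the zigzag order, this is the quotient of the major index enumerator of the
linear extensions by (1 - q) ... (1 - q^(2m+1)) ([zigzag_gen_tEstar]).

Infinite matrices are avoided: entries are bounded by some B, the determinantal
identities are then exact, and all series agree up to order B with the
unbounded ones ([eq_upto]). The exponent of q in the theorem is the total shift
r over all slices minus the exponent from the change of basis
([shift_sumE]). *)

Set Implicit Arguments.
Unset Strict Implicit.
Unset Printing Implicit Defensive.
Import GRing.Theory.
Local Open Scope ring_scope.

(** * Interlacing tuples and minors of the summation matrix *)

(** Multilinearity in the columns: each column of W V is the combination of
the columns of W with coefficients in the same column of V. *)
Lemma det_mulmx_expand (R : comNzRingType) (k p : nat)
    (W : 'M[R]_(k, p)) (V : 'M[R]_(p, k)) :
  \det (W *m V) =
  \sum_(x : {ffun 'I_k -> 'I_p}) (\prod_j V (x j) j) * \det (colsub x W).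
Proof.
rewrite -det_tr /determinant.
under eq_bigr => s _.
  under eq_bigr => i _ do rewrite !mxE.
  rewrite bigA_distr_bigA /= mulr_sumr.
  over.
rewrite exchange_big; apply: eq_bigr => x _ /=.
rewrite -/(determinant (colsub x W)) -det_tr /determinant mulr_sumr.
apply: eq_bigr => s _; rewrite big_split /= mulrA [RHS]mulrC.
by congr (_ * _ * _); apply: eq_bigr => i _; rewrite !mxE.
Qed.

Definition strict (k p : nat) (s : {ffun 'I_k -> 'I_p}) : bool :=
  [forall r : 'I_k, forall r' : 'I_k, (val r' == r.+1) ==> (s r < s r')%N].

(** The order is b_0 <= a_0 < b_1 <= a_1 < ...; the inner tuple comes first.
Both tuples are then strictly increasing. *)
Definition interlace (k p : nat) (b a : {ffun 'I_k -> 'I_p}) : bool :=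
  [forall r : 'I_k, (b r <= a r)%N] &&
  [forall r : 'I_k, forall r' : 'I_k, (val r' == r.+1) ==> (a r < b r')%N].

Lemma strictP (k p : nat) (s : {ffun 'I_k -> 'I_p}) :
  reflect (forall r r' : 'I_k, val r' = r.+1 -> (s r < s r')%N) (strict s).
Proof.
apply: (iffP forallP) => [h r r' e|h r].
  by move/forallP/(_ r')/implyP: (h r); apply; apply/eqP.
by apply/forallP => r'; apply/implyP => /eqP; apply: h.
Qed.

Lemma interlaceP (k p : nat) (b a : {ffun 'I_k -> 'I_p}) :
  reflect ((forall r, (b r <= a r)%N) /\
           (forall r r' : 'I_k, val r' = r.+1 -> (a r < b r')%N)) (interlace b a).
Proof.
apply: (iffP andP) => -[/= h1 h2]; split.
- exact/forallP.
- move=> r r' e; move/forallP/(_ r)/forallP/(_ r')/implyP: h2; apply; exact/eqP.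
- exact/forallP.
- by apply/forallP=> r; apply/forallP => r'; apply/implyP => /eqP; apply: h2.
Qed.

Lemma interlace_strict_in (k p : nat) (b a : {ffun 'I_k -> 'I_p}) :
  interlace b a -> strict b.
Proof.
move=> /interlaceP[h1 h2]; apply/strictP => r r' e.
exact: leq_ltn_trans (h1 r) (h2 _ _ e).
Qed.

Lemma interlace_strict_out (k p : nat) (b a : {ffun 'I_k -> 'I_p}) :
  interlace b a -> strict a.
Proof.
move=> /interlaceP[h1 h2]; apply/strictP => r r' e.
exact: leq_trans (h2 _ _ e) (h1 r').
Qed.

Section Steps.
Variables (R : comNzRingType) (k p : nat).
Implicit Types (W : 'M[R]_(k, p)) (s x : {ffun 'I_k -> 'I_p}).

(** Right multiplication by this matrix sums a row over the indices >= b, and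
by its transpose over the indices <= a. *)
Definition gemx : 'M[R]_p := \matrix_(a, b) (b <= a)%N%:R.

(** Right multiplication by this matrix subtracts from each column the
previous one; by its transpose, the next one. *)
Definition diffmx : 'M[R]_k :=
  \matrix_(i, j) ((i == j)%:R - (val j == i.+1)%:R).

Lemma det_diffmx : \det diffmx = 1.
Proof.
rewrite -det_tr det_trig; last first.
  apply/is_trig_mxP => i j ij; rewrite !mxE.
  have -> : (j == i) = false by apply/negbTE/eqP => e; rewrite e ltnn in ij.
  have -> : (val i == j.+1) = false by apply/negbTE/eqP => /= e; lia.
  by rewrite subrr.
rewrite big1 // => i _; rewrite !mxE eqxx.
have -> : (val i == i.+1) = false by apply/negbTE/eqP => /= e; lia.
by rewrite subr0.
Qed.

Lemma colsub_mulmx W (V : 'M[R]_p) s : colsub s (W *m V) = W *m colsub s V.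
Proof. by apply/matrixP => i j; rewrite !mxE; apply: eq_bigr => l _; rewrite !mxE. Qed.

Lemma prod_natrb (T : finType) (P : pred T) : \prod_i (P i)%:R = [forall i, P i]%:R :> R.
Proof.
case: (boolP [forall i, P i]) => [/forallP h|].
  by rewrite big1 // => i _; rewrite h.
by move=> /forallPn[i hi]; rewrite (bigD1 i) //= (negbTE hi) mul0r.
Qed.

Lemma sum_pick1 (T : finType) (F : T -> R) (P : pred T) (j0 : T) :
  P j0 -> (forall j, P j -> j = j0) -> \sum_j F j * (P j)%:R = F j0.
Proof.
move=> h0 h; rewrite (bigD1 j0) //= h0 mulr1 big1 ?addr0 // => j nj.
case: (boolP (P j)) => [/h e|_]; last by rewrite mulr0.
by rewrite e eqxx in nj.
Qed.

Lemma sum_pick0 (T : finType) (F : T -> R) (P : pred T) :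
  (forall j, ~~ P j) -> \sum_j F j * (P j)%:R = 0.
Proof. by move=> h; rewrite big1 // => j _; rewrite (negbTE (h j)) mulr0. Qed.

(** Subtracting the previous column, column j becomes the sum of the columns
of W with index in the interval from s_(j-1), excluded, to s_j, included.
Choosing one index in each of these consecutive disjoint intervals is choosing
a tuple that interlaces with s. *)
Lemma det_interlace_out W s : strict s ->
  \det (colsub s (W *m gemx^T)) = \sum_(x | interlace x s) \det (colsub x W).
Proof.
move=> /strictP hs.
rewrite colsub_mulmx -[LHS]mulr1 -det_diffmx -det_mulmx -mulmxA det_mulmx_expand.
rewrite [RHS]big_mkcond; apply: eq_bigr => x _.
pose P j := (x j <= s j)%N && [forall j' : 'I_k, (val j == j'.+1) ==> (s j' < x j)%N].
have -> : \prod_j (colsub s gemx^T *m diffmx) (x j) j = \prod_j (P j)%:R.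
  apply: eq_bigr => j _; rewrite mxE.
  under eq_bigr => i _ do rewrite !mxE mulrBr.
  rewrite sumrB (@sum_pick1 _ _ _ j) // ; last by move=> i /eqP.
  rewrite /P; case: (boolP [exists i : 'I_k, val j == i.+1]) => [/existsP[i hi]|].
    rewrite (@sum_pick1 _ _ _ i) //; last first.
      by move=> i' /eqP; rewrite (eqP hi) => -[e]; apply: val_inj.
    have -> : [forall j' : 'I_k, (val j == j'.+1) ==> (s j' < x j)%N] = (s i < x j)%N.
      apply/forallP/idP => [/(_ i)|h i']; first by rewrite hi.
      by apply/implyP => /eqP; rewrite (eqP hi) => -[/val_inj <-].
    have h3 := hs _ _ (eqP hi).
    case: (ltnP (s i) (x j)) => h1; case: (leqP (x j) (s j)) => h2;
      rewrite /= ?subrr ?subr0 //; lia.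
  move=> /existsPn hn; rewrite sum_pick0 // subr0.
  have -> : [forall j' : 'I_k, (val j == j'.+1) ==> (s j' < x j)%N] = true.
    by apply/forallP => i; rewrite (negbTE (hn i)).
  by rewrite andbT.
rewrite prod_natrb.
have -> : [forall i, P i] = interlace x s.
  apply/forallP/interlaceP => [h|[h1 h2] j].
    split=> [r|r r' e]; first by case/andP: (h r).
    case/andP: (h r') => _ /forallP/(_ r)/implyP; apply; exact/eqP.
  rewrite /P h1; apply/forallP => j'; apply/implyP => /eqP e; exact: h2.
by case: (interlace x s); rewrite ?mul1r ?mul0r.
Qed.

(** The mirror image: subtracting the next column leaves the sum of the
columns of W with index from s_j, included, to s_(j+1), excluded, the last
interval being unbounded. *)
Lemma det_interlace_in W s : strict s ->
  \det (colsub s (W *m gemx)) = \sum_(x | interlace s x) \det (colsub x W).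
Proof.
move=> /strictP hs.
rewrite colsub_mulmx -[LHS]mulr1 -det_diffmx -[\det diffmx]det_tr.
rewrite -det_mulmx -mulmxA det_mulmx_expand.
rewrite [RHS]big_mkcond; apply: eq_bigr => x _.
pose P j := (s j <= x j)%N && [forall j' : 'I_k, (val j' == j.+1) ==> (x j < s j')%N].
have -> : \prod_j (colsub s gemx *m diffmx^T) (x j) j = \prod_j (P j)%:R.
  apply: eq_bigr => j _; rewrite mxE.
  under eq_bigr => i _ do rewrite !mxE mulrBr.
  rewrite sumrB (@sum_pick1 _ _ _ j) // ; last by move=> i /eqP.
  rewrite /P; case: (boolP [exists i : 'I_k, val i == j.+1]) => [/existsP[i hi]|].
    rewrite (@sum_pick1 _ _ _ i) //; last first.
      by move=> i' /eqP; rewrite -(eqP hi) => /val_inj.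
    have -> : [forall j' : 'I_k, (val j' == j.+1) ==> (x j < s j')%N] = (x j < s i)%N.
      apply/forallP/idP => [/(_ i)|h i']; first by rewrite hi.
      by apply/implyP; rewrite -(eqP hi) => /eqP/val_inj ->.
    have h3 := hs _ _ (eqP hi).
    case: (ltnP (x j) (s i)) => h1; case: (leqP (s j) (x j)) => h2;
      rewrite /= ?subrr ?subr0 //; lia.
  move=> /existsPn hn; rewrite sum_pick0 // subr0.
  have -> : [forall j' : 'I_k, (val j' == j.+1) ==> (x j < s j')%N] = true.
    by apply/forallP => i; rewrite (negbTE (hn i)).
  by rewrite andbT.
rewrite prod_natrb.
have -> : [forall i, P i] = interlace s x.
  apply/forallP/interlaceP => [h|[h1 h2] j].
    split=> [r|r r' e]; first by case/andP: (h r).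
    case/andP: (h r) => _ /forallP/(_ r')/implyP; apply; exact/eqP.
  rewrite /P h1; apply/forallP => j'; apply/implyP => /eqP e; exact: h2.
by case: (interlace s x); rewrite ?mul1r ?mul0r.
Qed.

End Steps.

(** * Walks of alternately interlacing tuples *)

(** A path for a relation that depends on the index of the step. *)
Fixpoint ipath (S : Type) (rel : nat -> S -> S -> bool) (i : nat) (x : S) (l : seq S) :=
  if l is y :: l' then rel i x y && ipath rel i.+1 y l' else true.

Lemma ipath_rcons (S : Type) (rel : nat -> S -> S -> bool) i x l y :
  ipath rel i x (rcons l y) = ipath rel i x l && rel (i + size l)%N (last x l) y.
Proof.
elim: l i x => [|z l IH] i x /=; first by rewrite addn0 andbT.
by rewrite IH addSnnS andbA.
Qed.

Lemma ipathP (S : Type) (rel : nat -> S -> S -> bool) (x0 : S) i x l :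
  reflect (forall j, (j < size l)%N -> rel (i + j)%N (nth x0 (x :: l) j) (nth x0 l j))
          (ipath rel i x l).
Proof.
elim: l i x => [|y l IH] i x /=; first by apply: ReflectT.
apply: (iffP andP) => [[h1 /IH h2] [|j]|h].
- by rewrite addn0.
- by move=> hj; rewrite -addSnnS; apply: h2.
- split; first by have := h 0%N isT; rewrite addn0.
  by apply/IH => j hj; rewrite addSnnS; apply: h.
Qed.

Lemma sum_tuple_rcons (R : nmodType) (S : finType) t (F : seq S -> R) :
  \sum_(l : t.+1.-tuple S) F l = \sum_(l : t.-tuple S) \sum_(y : S) F (rcons l y).
Proof.
rewrite pair_big /= (reindex (fun p : t.-tuple S * S => [tuple of rcons p.1 p.2])) //=.
apply: onW_bij; apply: inj_card_bij.
  move=> [l y] [l' y'] /= /(congr1 val) /= /rcons_inj[e ->].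
  by congr (_, _); apply: val_inj.
by rewrite card_prod !card_tuple expnSr.
Qed.

Lemma sum_tuple0 (R : nmodType) (S : finType) (F : seq S -> R) :
  \sum_(l : 0.-tuple S) F l = F [::].
Proof. by rewrite (big_pred1 [tuple]) // => l; apply/esym/eqP; exact: tuple0. Qed.

(** Along a walk, inner and outer tuples alternate, and the step of index 0
goes from the inner ground state to an outer tuple. *)
Definition walk_rel (k p : nat) (t : nat) (x y : {ffun 'I_k -> 'I_p}) : bool :=
  if odd t then interlace y x else interlace x y.

Definition state_sum (k p : nat) (y : {ffun 'I_k -> 'I_p}) : nat := (\sum_r y r)%N.

Section Walks.
Variables (R : comNzRingType) (q : R) (k p : nat) (kp : (k <= p.+1)%N).
Local Notation S := {ffun 'I_k -> 'I_p.+1}.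

(** The least strictly increasing tuple 0, 1, ..., k-1. *)
Definition ground : S := [ffun r => widen_ord kp r].

Definition qdiag : 'M[R]_p.+1 := diag_mx (\row_a q ^+ a).
Definition step_mx t : 'M[R]_p.+1 := if odd t then gemx R p.+1 else (gemx R p.+1)^T.
Definition unit_rows : 'M[R]_(k, p.+1) := \matrix_(i, a) (val i == a)%:R.
(** Row i of this k-rowed matrix is the weighted sum over the first t steps
of single paths that start at i. *)
Fixpoint walk_mx t : 'M[R]_(k, p.+1) :=
  if t is t'.+1 then walk_mx t' *m step_mx t' *m qdiag else unit_rows.

Lemma det_step (W : 'M[R]_(k, p.+1)) t s : strict s ->
  \det (colsub s (W *m step_mx t)) = \sum_(y | walk_rel t y s) \det (colsub y W).
Proof. by rewrite /step_mx /walk_rel => hs; case: (odd t); rewrite ?det_interlace_out ?det_interlace_in. Qed.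

Lemma walk_rel_strict t (x y : S) : walk_rel t x y -> strict x /\ strict y.
Proof.
by rewrite /walk_rel; case: (odd t) => h; split;
  first [exact: interlace_strict_in h | exact: interlace_strict_out h].
Qed.

Lemma strict_ground : strict ground.
Proof. by apply/strictP => r r' e; rewrite !ffunE /= -[nat_of_ord r']/(val r') e. Qed.

Lemma strict_ge (s : S) : strict s -> forall r : 'I_k, (r <= s r)%N.
Proof.
move=> /strictP hs [r hr] /=; elim: r hr => [|r IH] hr //.
have hr' : (r < k)%N by apply: ltnW.
exact: leq_ltn_trans (IH hr') (hs (Ordinal hr') (Ordinal hr) erefl).
Qed.

(** The values of a strict tuple grow at least as fast as the indices, from
both ends; below k there is no room for a gap. *)
Lemma strict_last (s : S) : strict s -> (forall r : 'I_k, (s r < k)%N) -> s = ground.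
Proof.
move=> /strictP hs hlt.
(* Downward induction on the index: s_r leaves room for the k - 1 - r
   values above it. *)
have h d : forall r : 'I_k, (k - r.+1 = d)%N -> (s r + d < k)%N.
  elim: d => [|d IH] r hr; first by rewrite addn0.
  have hr' : (r.+1 < k)%N by have := ltn_ord r; lia.
  have h1 : (k - (Ordinal hr').+1 = d)%N by rewrite /=; lia.
  by have := IH _ h1; have := hs r (Ordinal hr') erefl; lia.
apply/ffunP => r; apply: val_inj; rewrite ffunE /=.
have := h _ r erefl; have : (r <= s r)%N by apply: strict_ge; apply/strictP.
by have := ltn_ord r; lia.
Qed.

(** A strict tuple other than the ground state has a value that is at least
k, and the corresponding column of the unit rows vanishes. *)
Lemma det_unit_rows (s : S) : strict s -> \det (colsub s unit_rows) = (s == ground)%:R.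
Proof.
move=> hs; case: eqP => [->|hne].
  rewrite (_ : colsub _ _ = 1%:M) ?det1 //.
  by apply/matrixP => i j; rewrite !mxE ffunE /=.
have [r hr] : exists r, (k <= s r)%N.
  apply/existsP/negbNE/negP => /existsPn h; apply: hne; apply: strict_last => // r.
  by rewrite ltnNge.
rewrite -det_tr /determinant big1 // => u _.
rewrite (bigD1 r) //= !mxE; case: eqP => [e|]; last by rewrite !(mul0r, mulr0).
by have := ltn_ord (u r); have : (val (u r) = s r) by []; move: hr => /=; lia.
Qed.

Lemma det_colsub_qdiag (W : 'M[R]_(k, p.+1)) (s : S) :
  \det (colsub s (W *m qdiag)) = q ^+ state_sum s * \det (colsub s W).
Proof.
have -> : colsub s (W *m qdiag) = colsub s W *m diag_mx (\row_r q ^+ s r).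
  by apply/matrixP => i j; rewrite !mul_mx_diag !mxE.
rewrite det_mulmx det_diag mulrC /state_sum -prodrXr; congr (_ * _).
by apply: eq_bigr => r _; rewrite mxE.
Qed.

Definition walk (l : seq S) := ipath (@walk_rel k p.+1) 0 ground l.
Definition walk_sum (l : seq S) : nat := (\sum_(y <- l) state_sum y)%N.

(** The Lindstrom-Gessel-Viennot determinant for these paths, obtained one
step at a time from the two column operations. *)
Lemma det_walk t s : strict s ->
  \det (colsub s (walk_mx t *m step_mx t)) =
  \sum_(l : t.-tuple S | walk (rcons l s)) q ^+ walk_sum l.
Proof.
elim: t s => [|t IH] s hs; rewrite det_step // big_mkcond [RHS]big_mkcond.
  rewrite (sum_tuple0 (fun l => if walk (rcons l s) then q ^+ walk_sum l else 0)) /=.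
  rewrite (bigD1 ground) //= big1 ?addr0 => [|y ny].
    by rewrite /walk /= andbT det_unit_rows ?strict_ground // eqxx /walk_sum big_nil.
  by case: ifP => // /walk_rel_strict[hy _]; rewrite det_unit_rows // (negbTE ny).
rewrite (sum_tuple_rcons t (fun l => if walk (rcons l s) then q ^+ walk_sum l else 0)).
rewrite exchange_big; apply: eq_bigr => y _ /=.
case: ifP => [hy|hy]; last first.
  rewrite big1 // => l _; rewrite /walk ipath_rcons last_rcons size_rcons size_tuple.
  by rewrite hy andbF.
rewrite det_colsub_qdiag IH; last by case: (walk_rel_strict hy).
rewrite mulr_sumr [LHS]big_mkcond; apply: eq_bigr => l _.
rewrite /walk [ipath _ _ _ (rcons (rcons l y) s)]ipath_rcons last_rcons size_rcons size_tuple.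
rewrite hy andbT; case: ifP => // _.
by rewrite /walk_sum -cats1 big_cat /= big_seq1 addnC exprD.
Qed.

(** Two steps, from an inner index to the next one, weighted by the outer
index between them; it is symmetric. Its product with D in [Pmx] also weights
the inner index that is reached. *)
Definition Qmx : 'M[R]_p.+1 := (gemx R p.+1)^T *m qdiag *m gemx R p.+1.
Definition Pmx : 'M[R]_p.+1 := Qmx *m qdiag.

Lemma walk_mx_even m : walk_mx m.*2 = unit_rows *m (Pmx ^+ m).
Proof.
elim: m => [|m IH]; first by rewrite expr0 mulmx1.
rewrite doubleS /= IH /step_mx /= odd_double /= exprSr -mulmxE.
by rewrite /Pmx /Qmx !mulmxA.
Qed.

(** The last step leads back to the ground state, which selects the columns
0, ..., k-1 of the path matrix. *)
Lemma det_zigzag_walk m :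
  \det (\matrix_(i < k, j < k) (Pmx ^+ m *m Qmx) (widen_ord kp i) (widen_ord kp j)) =
  \sum_(l : (m.*2.+1).-tuple S | walk (rcons l ground)) q ^+ walk_sum l.
Proof.
rewrite -det_walk; last exact: strict_ground.
rewrite /= walk_mx_even /step_mx /= odd_double /=.
have -> : unit_rows *m Pmx ^+ m *m (gemx R p.+1)^T *m qdiag *m gemx R p.+1
     = unit_rows *m (Pmx ^+ m *m Qmx) by rewrite /Qmx !mulmxA.
congr (\det _); apply/matrixP => i j; rewrite [LHS]mxE [RHS]mxE ffunE [RHS]mxE.
rewrite (bigD1 (widen_ord kp i)) //= [unit_rows _ _]mxE /= eqxx mul1r big1 ?addr0 // => a ha.
rewrite [unit_rows _ _]mxE; case: eqP => [e|]; last by rewrite mul0r.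
by case/eqP: ha; apply: val_inj.
Qed.

End Walks.

(** * From a minor to a Hankel determinant *)

Lemma det_reindex (R : comNzRingType) k (F : 'I_k -> 'I_k -> R) (s : 'S_k) :
  \det (\matrix_(i, j) F (s i) (s j)) = \det (\matrix_(i, j) F i j).
Proof.
have -> : \matrix_(i, j) F (s i) (s j) = row_perm s (col_perm s (\matrix_(i, j) F i j)).
  by apply/matrixP => i j; rewrite !mxE.
rewrite row_permE col_permE !det_mulmx !det_perm odd_permV mulrCA -signr_addb.
by rewrite addbb mulr1.
Qed.

Section Hankel.
Variables (R : comNzRingType) (q : R) (p : nat).
Local Notation A := (gemx R p.+1).
Local Notation D := (qdiag q p).
Local Notation Q := (Qmx q p).
Local Notation P := (Pmx q p).

Definition erow (i : nat) : 'rV[R]_p.+1 := delta_mx 0 (inord i).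

Lemma erow_mul (i : nat) (M : 'M[R]_p.+1) j : (erow i *m M) 0 j = M (inord i) j.
Proof. by rewrite -rowE mxE. Qed.

Lemma erow_qdiag i : (i <= p)%N -> erow i *m D = q ^+ i *: erow i.
Proof.
move=> ip; apply/rowP => j; rewrite erow_mul !mxE.
case: (eqVneq j (inord i)) => _; last by rewrite mulr0n mulr0.
by rewrite inordK // mulr1n mulr1.
Qed.

Lemma erowE i (j : 'I_p.+1) : (i <= p)%N -> erow i 0 j = (val j == i)%:R.
Proof. by move=> ip; rewrite !mxE eqxx /= -(inj_eq val_inj) /= inordK. Qed.

Lemma erowB_mul i i' (M : 'M[R]_p.+1) j :
  ((erow i - erow i') *m M) 0 j = M (inord i) j - M (inord i') j.
Proof. by rewrite mulmxBl /erow -!rowE !mxE. Qed.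

(** Differences of consecutive unit rows invert the transposed summation
matrix; in the same way [erow_gemxS] inverts the summation matrix. Together they
make the inverse of P tridiagonal. *)
Lemma erow_gemxT i : (i < p)%N -> (erow i - erow i.+1) *m A^T = erow i.
Proof.
move=> ip; apply/rowP => j; rewrite erowB_mul.
rewrite erowE ?(ltnW ip) // !mxE !inordK //; last exact: ltnW.
by case: (ltngtP i j) => h /=; rewrite ?subrr ?subr0.
Qed.

Lemma erow_gemx0 : erow 0 *m A = erow 0.
Proof.
apply/rowP => j; by rewrite erow_mul erowE // !mxE inordK // leqn0.
Qed.

Lemma erow_gemxS i : (i < p)%N -> (erow i.+1 - erow i) *m A = erow i.+1.
Proof.
move=> ip; apply/rowP => j; rewrite erowB_mul.
rewrite erowE // !mxE !inordK //; last exact: ltnW.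
by case: (ltngtP j i.+1); case: (ltngtP j i) => h1 h2 /=; rewrite ?subrr ?subr0 //; lia.
Qed.

(** A difference of consecutive rows cancels the first factor of
P = A^T D A D. *)
Lemma erow_step i : (i < p)%N ->
  (erow i - erow i.+1) *m P = q ^+ i *: (erow i *m A *m D).
Proof.
move=> ip; rewrite /Pmx /Qmx !mulmxA erow_gemxT // erow_qdiag ?(ltnW ip) //.
by rewrite -!scalemxAl.
Qed.

Lemma erow_rec0 : (0 < p)%N -> erow 1 *m P = erow 0 *m P - erow 0.
Proof.
move=> p0; have := erow_step p0.
rewrite erow_gemx0 erow_qdiag // expr0 !scale1r mulmxBl => h.
by rewrite -[X in _ = _ - X]h opprB addrC subrK.
Qed.

(** Two successive differences undo the whole of P. The second one is
weighted by q, to balance the factors q^i and q^(i+1) left by the first D. *)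
Lemma erow_recS i : (i.+1 < p)%N ->
  erow i.+2 *m P = (1 + q) *: (erow i.+1 *m P) - q *: (erow i *m P)
                   - q ^+ (i.+1).*2 *: erow i.+1.
Proof.
move=> ip; have h1 := erow_step ip; have h0 := erow_step (ltnW ip).
have h : (erow i.+1 - erow i.+2) *m P - q *: ((erow i - erow i.+1) *m P)
         = q ^+ (i.+1).*2 *: erow i.+1.
  rewrite h1 h0 scalerA -exprS -scalerBr -!mulmxBl erow_gemxS ?(ltnW ip) //.
  by rewrite erow_qdiag ?(ltnW ip) // scalerA -exprD addnn.
rewrite -h !mulmxBl !scalerBr scalerDl scale1r.
set a := erow i.+1 *m P; set b := erow i.+2 *m P; set c := q *: (erow i *m P).
by apply/rowP => j; rewrite !mxE; ring.
Qed.

(** The three-term recurrence [erow_recS] multiplied by P^(i+1), read as a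
recurrence for polynomials in P applied to the row of index 0. *)
Fixpoint hpol (i : nat) : {poly R} :=
  match i with
  | 0 => 1
  | i'.+1 => match i' with
    | 0 => 'X - 1
    | i''.+1 => ((1 + q) *: 'X - (q ^+ (i''.+1).*2)%:P) * hpol i' - q *: 'X^2 * hpol i''
    end
  end.

Lemma hpolSS i :
  hpol i.+2 = ((1 + q) *: 'X - (q ^+ (i.+1).*2)%:P) * hpol i.+1 - q *: 'X^2 * hpol i.
Proof. by []. Qed.

Lemma size_hpol i : (size (hpol i) <= i.+1)%N.
Proof.
suff : (size (hpol i) <= i.+1)%N && (size (hpol i.+1) <= i.+2)%N by case/andP.
elim: i => [|i /andP[h1 h2]]; first by rewrite /= size_poly1 size_XsubC.
apply/andP; split; first exact: h2.
rewrite hpolSS; apply: (leq_trans (size_polyD _ _)).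
rewrite size_polyN geq_max; apply/andP; split; apply: (leq_trans (size_polyMleq _ _)).
  have h3 : (size ((1 + q) *: 'X - (q ^+ (i.+1).*2)%:P)%R <= 2)%N.
    apply: (leq_trans (size_polyD _ _)); rewrite size_polyN geq_max.
    rewrite (leq_trans (size_scale_leq _ _)) ?size_polyX //.
    by rewrite (leq_trans (size_polyC_leq1 _)).
  by move: h2 h3; lia.
have h3 : (size (q *: 'X^2 : {poly R})%R <= 3)%N.
  by rewrite (leq_trans (size_scale_leq _ _)) ?size_polyXn.
by rewrite -subn1; apply: leq_trans (leq_sub2r 1 (leq_add h3 h1)) _; rewrite subn1.
Qed.

(** The constant terms are the diagonal coefficients of the triangular change
of basis. *)
Lemma hpol0 i : (hpol i)`_0 = (-1) ^+ i * q ^+ (i * (i - 1)).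
Proof.
elim: i => [|[|i] IH]; first by rewrite coef1 !expr0 mulr1.
  by rewrite /= coefB coefX coef1 sub0r expr1 expr0 mulr1.
rewrite hpolSS coefB -!horner_coef0 !hornerE !horner_coef0 IH /=.
rewrite !(mulr0, mul0r, subr0).
rewrite [(-1) ^+ i.+2]exprS !mulNr mul1r mulrCA -exprD; congr (- (_ * q ^+ _)).
by rewrite !subn1 /=; lia.
Qed.

(** Stated for arbitrary scalars, so that simplification leaves the
powers of q alone. *)
Lemma horner_mx_rec (a b c : R) (u v : {poly R}) :
  horner_mx P ((a *: 'X - b%:P) * u - c *: 'X^2 * v) =
  (a *: P - b%:M) *m horner_mx P u - (c *: (P *m P)) *m horner_mx P v.
Proof.
rewrite rmorphB !rmorphM /= rmorphB /= horner_mx_C !horner_mxZ rmorphXn /= horner_mx_X.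
by rewrite -!mulmxE.
Qed.

Lemma erow_hpol i : (i <= p)%N -> erow i *m P ^+ i = erow 0 *m horner_mx P (hpol i).
Proof.
suff : ((i <= p)%N -> erow i *m P ^+ i = erow 0 *m horner_mx P (hpol i)) /\
   ((i.+1 <= p)%N -> erow i.+1 *m P ^+ i.+1 = erow 0 *m horner_mx P (hpol i.+1)) by case.
elim: i => [|i [IH0 IH1]].
  split=> h; first by rewrite /= expr0 rmorph1.
  by rewrite /= rmorphB /= horner_mx_X rmorph1 expr1 mulmxBr mulmx1 erow_rec0.
split=> // ip; rewrite hpolSS.
have e1 := IH1 (ltnW ip); have e0 := IH0 (ltnW (ltnW ip)).
have c1 : P *m horner_mx P (hpol i.+1) = horner_mx P (hpol i.+1) *m P.
  exact: comm_mx_horner.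
have c0 : P *m horner_mx P (hpol i) = horner_mx P (hpol i) *m P.
  exact: comm_mx_horner.
have hr := erow_recS ip; rewrite horner_mx_rec.
move: hr c1 c0 e1 e0; move: (Pmx q p) => M hr c1 c0 e1 e0.
rewrite mulmxBr mulmxBl mul_scalar_mx mulmxBr.
rewrite -!scalemxAl -!scalemxAr c1 -[M *m M *m _]mulmxA c0.
rewrite [M *m (_ *m M)]mulmxA c0 ![in RHS]mulmxA -e1 -e0 [in LHS]exprS -mulmxE.
rewrite [in LHS]mulmxA hr !mulmxBl -!scalemxAl.
have -> : erow i.+1 *m M *m M ^+ i.+1 = erow i.+1 *m M ^+ i.+1 *m M.
  by rewrite -2!mulmxA !mulmxE -exprS -exprSr.
have -> : erow i *m M *m M ^+ i.+1 = erow i *m M ^+ i *m M *m M.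
  by rewrite -3!mulmxA !mulmxE -exprS mulrA -!exprSr.
by rewrite addrAC.
Qed.

Lemma erow_hpol_sum i m : (i <= p)%N -> (i <= m)%N ->
  erow i *m P ^+ m = \sum_(r < i.+1) (hpol i)`_r *: (erow 0 *m P ^+ (m - i + r)).
Proof.
move=> ip im; rewrite -{1}(subnKC im) exprD -mulmxE mulmxA erow_hpol //.
rewrite -{1}[hpol i]coefK.
have -> : \poly_(r < size (hpol i)) (hpol i)`_r = \poly_(r < i.+1) (hpol i)`_r.
  apply/polyP => r; rewrite !coef_poly; case: ltnP => h1; case: ltnP => h2 //.
    by have := size_hpol i; lia.
  by rewrite nth_default.
rewrite poly_def rmorph_sum mulmx_sumr mulmx_suml; apply: eq_bigr => r _.
rewrite /= horner_mxZ rmorphXn /= horner_mx_X -scalemxAr -scalemxAl -mulmxA mulmxE.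
by rewrite -exprD addnC.
Qed.

Section Det.
Variables (k : nat) (kp : (k.+1 <= p.+1)%N).

(** The change of basis between the rows of index i <= k of P^k and the rows
of index 0 of P^(k - c), which are collected in [Rmx]. *)
Definition Lmx : 'M[R]_k.+1 :=
  \matrix_(i, c) if (c <= i)%N then (hpol i)`_(i - c) else 0.
Definition Rmx : 'M[R]_(k.+1, p.+1) := \matrix_(c < k.+1) (erow 0 *m P ^+ (k - c)).

Lemma det_Lmx : \det Lmx = \prod_(i < k.+1) ((-1) ^+ i * q ^+ (i * (i - 1))).
Proof.
rewrite det_trig; first by apply: eq_bigr => i _; rewrite mxE leqnn subnn hpol0.
by apply/is_trig_mxP => i j ij; rewrite mxE leqNgt ij.
Qed.

Lemma unit_rows_Lmx : unit_rows R k.+1 p *m P ^+ k = Lmx *m Rmx.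
Proof.
apply/row_matrixP => i; rewrite !row_mul.
have -> : row i (unit_rows R k.+1 p) = erow i.
  apply/rowP => j; rewrite mxE [LHS]mxE erowE 1?eq_sym //.
  by have := ltn_ord i; lia.
have ip : (i <= p)%N by have := ltn_ord i; lia.
rewrite erow_hpol_sum //; last by rewrite -ltnS.
rewrite mulmx_sum_row (reindex_inj rev_ord_inj) /=.
rewrite (big_ord_widen k.+1 (fun c => (hpol i)`_(i.+1 - c.+1) *:
  (erow 0 *m P ^+ (k - i + (i.+1 - c.+1))))) //.
rewrite big_mkcond; apply: eq_bigr => c _; rewrite [row i _ 0 c]mxE [Lmx _ _]mxE rowK.
rewrite ltnS subSS; case: leqP => ci; last by rewrite scale0r.
by congr (_ *: (_ *m _ ^+ _)); have := ltn_ord i; lia.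
Qed.

(** P = Q D with Q and D symmetric, so Q intertwines P and its transpose. *)
Lemma mulmx_Q_trP m : Q *m (P ^+ m)^T = P ^+ m *m Q.
Proof.
have sQ : Q^T = Q by rewrite /Qmx !trmx_mul trmxK tr_diag_mx mulmxA.
elim: m => [|m IH]; first by rewrite expr0 trmx1 mulmx1 mul1mx.
rewrite exprSr -mulmxE trmx_mul.
have -> : P^T = D *m Q by rewrite /Pmx trmx_mul sQ tr_diag_mx.
rewrite mulmxA [Q *m (D *m Q)]mulmxA -[Q *m D]/(Pmx q p) -mulmxA IH mulmxA.
by rewrite mulmxE -exprS exprSr.
Qed.

(** By [mulmx_Q_trP], P^(n+2k) Q = P^k (P^n Q) (P^k)^T. The triangular matrix
[Lmx] comes out on both sides, which squares its determinant and removes the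
signs. What remains is the Hankel matrix with rows and columns in reverse
order. *)
Lemma det_hankel n :
  \det (\matrix_(i < k.+1, j < k.+1)
         (P ^+ (n + k.*2) *m Q) (widen_ord kp i) (widen_ord kp j)) =
  q ^+ (\sum_(i < k.+1) i * (i - 1)).*2 *
  \det (\matrix_(i < k.+1, j < k.+1) (P ^+ (n + i + j) *m Q) ord0 ord0).
Proof.
set M := \matrix_(i, j) _.
have -> : M = Lmx *m (Rmx *m (P ^+ n *m Q) *m Rmx^T) *m Lmx^T.
  have -> : Lmx *m (Rmx *m (P ^+ n *m Q) *m Rmx^T) *m Lmx^T =
      (Lmx *m Rmx) *m (P ^+ n *m Q) *m (Lmx *m Rmx)^T by rewrite trmx_mul !mulmxA.
  rewrite -unit_rows_Lmx trmx_mul.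
  have -> : unit_rows R k.+1 p *m P ^+ k *m (P ^+ n *m Q) *m ((P ^+ k)^T *m (unit_rows R k.+1 p)^T)
     = unit_rows R k.+1 p *m (P ^+ k *m P ^+ n *m (Q *m (P ^+ k)^T)) *m (unit_rows R k.+1 p)^T.
    by rewrite !mulmxA.
  rewrite mulmx_Q_trP [_ *m (_ *m Q)]mulmxA !mulmxE -!exprD -mulmxE.
  have -> : (k + n + k = n + k.*2)%N by lia.
  set X := P ^+ _ *m Q; apply/matrixP => i j; rewrite mxE.
  have rW a : row a (unit_rows R k.+1 p) = delta_mx 0 (widen_ord kp a).
    by apply/rowP => b; rewrite !mxE eqxx /= -(inj_eq val_inj) eq_sym.
  rewrite [RHS]mxE (bigD1 (widen_ord kp j)) //= big1 ?addr0 => [|b nb].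
    rewrite [_^T _ _]mxE [unit_rows _ _ _ _ _]mxE eqxx mulr1.
    have -> : (unit_rows R k.+1 p *m X) i (widen_ord kp j) =
        row i (unit_rows R k.+1 p *m X) 0 (widen_ord kp j).
      by rewrite [RHS]mxE.
    by rewrite row_mul rW -rowE [RHS]mxE.
  rewrite [_^T _ _]mxE [unit_rows _ _ _ j _]mxE; case: eqP => [e|]; last by rewrite mulr0.
  by case/eqP: nb; apply: val_inj.
rewrite !det_mulmx det_tr det_Lmx.
rewrite mulrAC -big_split /=; congr (_ * _).
  rewrite -addnn exprD -prodrXr -big_split /=; apply: eq_bigr => i _.
  by rewrite mulrACA -expr2 sqrr_sign mul1r.
rewrite -[RHS](det_reindex _ (perm rev_ord_inj)); congr (\det _).
apply/matrixP => i j; rewrite [RHS]mxE !permE /=.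
have rR a : row a Rmx = erow 0 *m P ^+ (k - a) by rewrite rowK.
have -> : (Rmx *m (P ^+ n *m Q) *m Rmx^T) i j =
    (row i Rmx *m (P ^+ n *m Q) *m (row j Rmx)^T) 0 0.
  by rewrite -!row_mul tr_row !mxE; apply: eq_bigr => c _; rewrite !mxE.
rewrite !rR trmx_mul; set a := (k - i)%N; set b := (k - j)%N; set e := erow 0.
have -> : e *m P ^+ a *m (P ^+ n *m Q) *m ((P ^+ b)^T *m e^T)
   = e *m (P ^+ a *m P ^+ n *m (Q *m (P ^+ b)^T)) *m e^T by rewrite !mulmxA.
rewrite mulmx_Q_trP [_ *m (_ *m Q)]mulmxA !mulmxE -!exprD -mulmxE.
have -> : (n + (k.+1 - i.+1) + (k.+1 - j.+1) = a + n + b)%N by rewrite /a /b; lia.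
have e0 : inord 0 = ord0 :> 'I_p.+1 by apply: val_inj; rewrite /= inordK.
set X := _ *m Q; rewrite /e /erow e0 trmx_delta -[delta_mx 0 ord0 *m X]rowE -colE.
by rewrite !mxE.
Qed.

End Det.
End Hankel.

(** * Congruence of power series and P-partitions of zigzags *)

Definition eq_upto (B : nat) (f g : fps int) := forall d, (d < B)%N -> fcoef f d = fcoef g d.

Lemma eq_upto_sym B f g : eq_upto B f g -> eq_upto B g f. Proof. by move=> h d /h. Qed.
Lemma eq_upto_trans B f g h : eq_upto B f g -> eq_upto B g h -> eq_upto B f h.
Proof. by move=> h1 h2 d hd; rewrite h1 ?h2. Qed.
Lemma eq_uptoD B f f' g g' : eq_upto B f f' -> eq_upto B g g' -> eq_upto B (f + g) (f' + g').
Proof. by move=> h1 h2 d hd /=; rewrite h1 ?h2. Qed.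
Lemma eq_uptoM B f f' g g' : eq_upto B f f' -> eq_upto B g g' -> eq_upto B (f * g) (f' * g').
Proof.
move=> h1 h2 d hd /=; apply: eq_bigr => i _; rewrite h1 ?h2 //.
  exact: leq_ltn_trans (leq_subr _ _) hd.
by apply: leq_ltn_trans hd; rewrite -ltnS.
Qed.
Lemma eq_upto_sum B (I : finType) (P : pred I) (F G : I -> fps int) :
  (forall i, P i -> eq_upto B (F i) (G i)) -> eq_upto B (\sum_(i | P i) F i) (\sum_(i | P i) G i).
Proof.
move=> h; apply: (big_ind2 (eq_upto B)) => // *; exact: eq_uptoD.
Qed.
Lemma eq_upto_prod B (I : finType) (P : pred I) (F G : I -> fps int) :
  (forall i, P i -> eq_upto B (F i) (G i)) -> eq_upto B (\prod_(i | P i) F i) (\prod_(i | P i) G i).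
Proof.
move=> h; apply: (big_ind2 (eq_upto B)) => // *; exact: eq_uptoM.
Qed.
Lemma eq_upto_det B k (M N : 'M[fps int]_k) :
  (forall i j, eq_upto B (M i j) (N i j)) -> eq_upto B (\det M) (\det N).
Proof. by move=> h; apply: eq_upto_sum => s _; apply: eq_uptoM => //; apply: eq_upto_prod. Qed.

Lemma fcoef_qXM a f d : fcoef ('q ^+ a * f) d = if (a <= d)%N then fcoef f (d - a) else 0.
Proof.
rewrite /=; case: leqP => h.
  rewrite (bigD1 (Ordinal (h : (a < d.+1)%N))) //= coef_fpsXn eqxx mul1r.
  rewrite big1 ?addr0 // => j; rewrite -val_eqE /= => /negPf ji.
  by rewrite coef_fpsXn ji mul0r.
rewrite big1 // => j _; rewrite coef_fpsXn.
by rewrite ltn_eqF ?mul0r // (leq_trans (ltn_ord j)).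
Qed.

Lemma fcoef_sum (I : finType) (P : pred I) (F : I -> fps int) d :
  fcoef (\sum_(i | P i) F i) d = \sum_(i | P i) fcoef (F i) d.
Proof. by apply: (big_morph (fun f => fcoef f d)). Qed.

Lemma eq_upto_qX0 B a : (B <= a)%N -> eq_upto B ('q ^+ a) 0.
Proof. by move=> h d hd; rewrite coef_fpsXn ltn_eqF // (leq_trans hd). Qed.

(** The geometric series from a to B - 1 telescopes; its upper end term has
order at least B. *)
Lemma eq_upto_geom B t a : (0 < t)%N ->
  eq_upto B ((1 - 'q ^+ t) * \sum_(x < B | (a <= x)%N) 'q ^+ (t * x)) ('q ^+ (t * a)).
Proof.
move=> t0; rewrite -(@big_geq_mkord _ _ _ a B xpredT (fun x => 'q ^+ (t * x))).
case: (leqP B a) => h.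
  rewrite big_geq // mulr0; apply/eq_upto_sym/eq_upto_qX0; apply: leq_trans h _.
  exact: leq_pmull.
have -> : (1 - 'q ^+ t) * (\sum_(a <= i < B) 'q ^+ (t * i)) = 'q ^+ (t * a) - 'q ^+ (t * B).
  have /= e := telescope_sumr (fun i => 'q ^+ (t * i)) (ltnW h).
  rewrite -[RHS]opprB -e mulr_sumr -sumrN; apply: eq_bigr => i _.
  by rewrite opprB mulnS exprD mulrBl mul1r.
rewrite -[X in eq_upto _ _ X]subr0; apply: eq_uptoD => // d hd /=.
by rewrite (@eq_upto_qX0 B) //; apply: leq_pmull.
Qed.

Section Chains.
Variables (B : nat) (e : nat -> nat).

(** Weakly decreasing sequences with prescribed drops: the step after the
entry of index i falls by at least e i. The first step is free, as the starting
point is a dummy. *)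
Definition descrel (i x y : nat) : bool := if i is i'.+1 then (y + e i' <= x)%N else true.

Definition chsum t h : fps int :=
  \sum_(l : t.-tuple 'I_B | ipath descrel 0 0%N (rcons (map val l) h)) 'q ^+ (\sum_(x <- l) x).

(** The last entry of the sequence is peeled off; it is a lower bound for the
remaining ones. *)
Lemma chsumS t h :
  chsum t.+1 h = \sum_(x < B | (h + e t <= x)%N) 'q ^+ x * chsum t x.
Proof.
rewrite /chsum big_mkcond /=.
rewrite (sum_tuple_rcons t (fun l : seq 'I_B =>
  if ipath descrel 0 0%N (rcons (map val l) h) then 'q ^+ (\sum_(x <- l) x) else 0)).
rewrite exchange_big [RHS]big_mkcond; apply: eq_bigr => x _ /=.
case: ifP => hx; last first.
  rewrite big1 // => l _; rewrite map_rcons ipath_rcons last_rcons size_rcons size_map.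
  by rewrite size_tuple /= hx andbF.
rewrite mulr_sumr [RHS]big_mkcond; apply: eq_bigr => l _.
rewrite map_rcons [ipath _ _ _ (rcons (rcons _ _) _)]ipath_rcons last_rcons size_rcons.
rewrite size_map size_tuple /= hx andbT; case: ifP => // _.
by rewrite -cats1 big_cat big_seq1 /= addnC exprD.
Qed.

(** Peeling off the last entry turns the claim for t into a geometric series
of ratio q^(t+1) that starts at h + e t, whence the new factor of the
denominator and the weight t+1 of a drop at that place. *)
Lemma eq_upto_chsum t h :
  eq_upto B (\prod_(1 <= i < t.+1) (1 - 'q ^+ i) * chsum t h)
        ('q ^+ (t * h + \sum_(i < t) i.+1 * e i)).
Proof.
elim: t h => [|t IH] h.
  rewrite big_geq // mul1r /chsum big_mkcond.
  rewrite (sum_tuple0 (fun l : seq 'I_B =>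
    if ipath descrel 0 0%N (rcons (map val l) h) then 'q ^+ (\sum_(x <- l) x) else 0)) /=.
  by rewrite big_nil big_ord0 mul0n.
rewrite big_nat_recr //= chsumS [_ * (1 - _)]mulrC -mulrA mulr_sumr.
set c := (\sum_(i < t) i.+1 * e i)%N.
apply: (@eq_upto_trans _ _ ((1 - 'q ^+ t.+1) *
    \sum_(x < B | (h + e t <= x)%N) 'q ^+ c * 'q ^+ (t.+1 * x))).
  apply: eq_uptoM => //; apply: eq_upto_sum => x hx.
  rewrite mulrCA -exprD.
  have -> : (c + t.+1 * x = x + (t * x + c))%N by lia.
  rewrite exprD; apply: eq_uptoM => //; exact: IH.
rewrite -mulr_sumr mulrCA big_ord_recr /= -/c.
have -> : (t.+1 * h + (c + t.+1 * e t) = c + t.+1 * (h + e t))%N by lia.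
rewrite exprD; apply: eq_uptoM => //; exact: eq_upto_geom.
Qed.

End Chains.

(** The rank of a is the number of elements below it. *)
Lemma lin_order_perm N (lt : rel 'I_N) :
  irreflexive lt -> transitive lt -> (forall a b, a != b -> lt a b || lt b a) ->
  exists s : 'S_N, forall a b, lt a b = (s a < s b)%N.
Proof.
move=> irr tr tot; pose rk a := #|[pred b | lt b a]|.
have rkN a : (rk a < N)%N.
  rewrite -[X in (_ < X)%N]card_ord; apply: proper_card; apply/properP; split.
    by apply/fintype.subsetP => b.
  by exists a; rewrite ?inE ?irr.
have mono a b : lt a b -> (rk a < rk b)%N.
  move=> ab; apply: proper_card; apply/properP; split.
    by apply/fintype.subsetP => c; rewrite !inE => ca; apply: tr ca ab.
  by exists a; rewrite !inE ?irr.
have inj : injective (fun a => Ordinal (rkN a)).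
  move=> a b /(congr1 val) /= e; apply/eqP/negPn/negP => /tot/orP[] /mono; rewrite e ltnn //.
exists (perm inj) => a b; rewrite !permE /=.
apply/idP/idP => [/mono //|h]; case: (eqVneq a b) => [e|/tot/orP[//|/mono]].
  by rewrite e ltnn in h.
by move=> h'; have := ltn_trans h h'; rewrite ltnn.
Qed.

(** A strictly increasing tuple of p+1 values below p+1 is the ground
state. *)
Lemma incr_perm1 p (u : 'S_p.+1) :
  (forall i j : 'I_p.+1, val j = i.+1 -> (u i < u j)%N) -> u = 1%g.
Proof.
move=> h; pose f := [ffun i => u i].
have hf : strict f by apply/strictP => i j e; rewrite !ffunE; apply: h.
have := strict_last (leqnn p.+1) hf; move=> hlast.
apply/permP => i; rewrite perm1.
have : f = ground (leqnn p.+1) by apply: hlast => r; apply: ltn_ord.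
by move/ffunP/(_ i); rewrite !ffunE => e; apply: val_inj; rewrite /= e.
Qed.

Section PPart.
Variables (p B : nat).
Hypothesis evp : ~~ odd p.
Local Notation N := p.+1.
Implicit Types (F : {ffun 'I_N -> 'I_B}) (s : 'S_N).

(** Positions in decreasing order of value, ties being broken by the labels
kappa. *)
Definition prec F (a b : 'I_N) : bool :=
  (F b < F a)%N || ((val (F a) == F b) && (kappa N a < kappa N b)%N).

Definition zigzag F : bool :=
  [forall i : 'I_N, forall j : 'I_N, (val j == i.+1) ==>
     if odd i then (F i <= F j)%N else (F j <= F i)%N].

(** The word of s^-1 lists the positions in the order [prec], which is tested
on consecutive positions. *)
Definition compat s F : bool :=
  [forall i : 'I_N, forall j : 'I_N, (val j == i.+1) ==> prec F (s^-1%g i) (s^-1%g j)].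

Lemma prec_perm F : exists s, forall a b, prec F a b = (s a < s b)%N.
Proof.
apply: lin_order_perm => [a|b a c|a b ab].
- by rewrite /prec !ltnn andbF.
- rewrite /prec /= => /orP[h1|/andP[/eqP h1 h1']] /orP[h2|/andP[/eqP h2 h2']]; apply/orP.
  + by left; exact: ltn_trans h2 h1.
  + by left; rewrite -h2.
  + by left; rewrite h1.
  + by right; rewrite h1 h2 eqxx /=; exact: ltn_trans h1' h2'.
- rewrite /prec /=; case: (ltngtP (F a) (F b)) => //= _.
  by rewrite -neq_ltn (inj_eq val_inj) (inj_eq perm_inj).
Qed.

(** Each filling is sorted by exactly one permutation, which decomposes the
set of all fillings. *)
Lemma compat_eq F s0 s : (forall a b, prec F a b = (s0 a < s0 b)%N) ->
  compat s F = (s == s0).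
Proof.
move=> h; apply/forallP/eqP => [hc|-> i]; last first.
  by apply/forallP => j; apply/implyP => /eqP /= e; rewrite h !permKV e.
(* In sorted order the ranks increase, so they are 0, 1, ..., p. *)
have e : (s^-1 * s0 = 1)%g.
  apply: incr_perm1 => i j ij; rewrite !permM -h.
  by move/forallP/(_ j)/implyP: (hc i); apply; rewrite ij.
by rewrite -[s0](mulKVg s) e mulg1.
Qed.

Lemma kappaE (i : 'I_N) : kappa N i = (if odd i then i.+1 else i.-1) :> nat.
Proof.
rewrite permE /kappa_fun val_insubd; have hi := ltn_ord i.
case: (boolP (odd i)) => oi /=; last by have -> : (i.-1 < N)%N by lia.
have -> // : (i.+1 < N)%N.
by rewrite ltnS ltn_neqAle -ltnS hi andbT; apply: contraNneq evp => <-.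
Qed.

(** The labelling kappa is natural: an end of a zigzag relation with the
larger value carries the smaller label. Hence a tie is always broken in the
direction of the weak inequality, and the zigzag inequalities hold for F exactly
when they hold for its sorting permutation. *)
Lemma ralt_zigzag F s : (forall a b, prec F a b = (s a < s b)%N) -> ralt s = zigzag F.
Proof.
move=> h; apply: eq_forallb => i; apply: eq_forallb => j.
case: eqP => //= ij; have ij' : nat_of_ord j = i.+1 := ij.
rewrite -!h /prec !kappaE ij' /=; case: (boolP (odd i)) => oi /=.
  by rewrite ltnSn andbT [RHS]leq_eqVlt orbC eq_sym.
have -> : (i.-1 < i.+2)%N by lia.
by rewrite andbT [RHS]leq_eqVlt orbC eq_sym.
Qed.

Definition zigzag_gen : fps int := \sum_(F | zigzag F) 'q ^+ (\sum_i F i).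

(** The indicator of a descent of s^-1 kappa at the place i. *)
Definition des_at s (i : nat) : nat :=
  (i < p)%N && ((s^-1 * kappa N)%g (inord i.+1) < (s^-1 * kappa N)%g (inord i))%N.

Lemma maj_des_at s : maj (s^-1 * kappa N)%g = (\sum_(i < N) i.+1 * des_at s i)%N.
Proof.
rewrite /maj; apply: eq_bigr => i _; rewrite /des_at inord_val.
case: (ltnP i p) => ip /=; last first.
  rewrite muln0 big1 // => j /andP[/eqP /= e _].
  by have := ltn_ord j; rewrite e; lia.
set c := (_ < _)%N; case: (boolP c) => hc.
  rewrite muln1 (big_pred1 (inord i.+1)) // => j /=.
  rewrite -(inj_eq val_inj) /= inordK // andb_idr // => /eqP e.
  by rewrite -(_ : inord i.+1 = j) //; apply: val_inj; rewrite /= inordK.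
rewrite muln0 big1 // => j /andP[/eqP /= e h]; case/negP: hc; rewrite /c.
by rewrite (_ : inord i.+1 = j) //; apply: val_inj; rewrite /= inordK -?e.
Qed.

Definition unsort s (l : N.-tuple 'I_B) : {ffun 'I_N -> 'I_B} := [ffun a => tnth l (s a)].

Lemma unsort_bij s : bijective (unsort s).
Proof.
apply: inj_card_bij; last by rewrite card_tuple card_ffun !card_ord.
move=> l l' /ffunP h; apply: eq_from_tnth => i.
by have := h (s^-1%g i); rewrite !ffunE permKV.
Qed.

(** Read in sorted order, a filling is weakly decreasing, and it decreases
strictly where the labels have a descent, since a tie is listed by increasing
label. *)
Lemma compat_unsort s l :
  compat s (unsort s l) = ipath (descrel (des_at s)) 0 0%N (rcons (map val l) 0%N).
Proof.
have nthl (i : 'I_N) : nth 0%N (rcons (map val l) 0%N) i = tnth l i.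
  rewrite nth_rcons size_map size_tuple ltn_ord.
  by rewrite (nth_map (tnth_default l i)) ?size_tuple // (tnth_nth (tnth_default l i)).
have precE (i j : 'I_N) : val j = i.+1 ->
    prec (unsort s l) (s^-1%g i) (s^-1%g j) = (tnth l j + des_at s i <= tnth l i)%N.
  move=> ij; have ip : (i < p)%N by have := ltn_ord j; rewrite ij.
  rewrite /prec !ffunE !permKV /des_at ip inord_val /= !permM.
  have -> : inord i.+1 = j by apply: val_inj; rewrite /= inordK.
  have : val (kappa N (s^-1%g i)) != val (kappa N (s^-1%g j)).
    rewrite (inj_eq val_inj) !(inj_eq perm_inj) -(inj_eq val_inj) ij.
    by apply/eqP => /=; lia.
  move=> /=; case: (ltngtP (kappa N (s^-1%g i)) (kappa N (s^-1%g j))) => //= _ _.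
    by rewrite andbT addn0 [RHS]leq_eqVlt orbC eq_sym.
  by rewrite andbF orbF addn1.
apply/forallP/(ipathP _ 0%N) => [h [|i] //|h i].
  rewrite size_rcons size_map size_tuple /= => hi; rewrite ltnS in hi.
  rewrite /= (nthl (Ordinal hi)).
  have /orP[/eqP[e]|hi1] : (i.+1 == N) || (i.+1 < N)%N by rewrite -leq_eqVlt.
    have -> : des_at s i = 0%N by rewrite /des_at e ltnn.
    have iN : (i.+1 < N)%N = false by rewrite e ltnn.
    by rewrite nth_rcons size_map size_tuple iN; case: ifP.
  rewrite (nthl (Ordinal hi1)) -(precE (Ordinal hi)) //.
  by move/forallP/(_ (Ordinal hi1))/implyP: (h (Ordinal hi)); apply.
apply/forallP => j; apply/implyP => /eqP ij; rewrite precE // -!nthl.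
have hj : (j < (size (rcons (map val l) 0%N)))%N.
  by rewrite size_rcons size_map size_tuple ltnS ltnW.
have := h j hj; have -> : nat_of_ord j = i.+1 by [].
by rewrite add0n.
Qed.

Lemma chain_compat s :
  \sum_(F | compat s F) 'q ^+ (\sum_i F i) = chsum B (des_at s) N 0.
Proof.
rewrite (reindex (unsort s)); last exact/onW_bij/unsort_bij.
apply: eq_big => [l|l _]; first exact: compat_unsort.
congr ('q ^+ _); rewrite big_tuple [RHS](reindex_inj (@perm_inj _ s)) /=.
by apply: eq_bigr => a _; rewrite ffunE.
Qed.

(** The fundamental decomposition of P-partitions: zigzag fillings are sorted
by linear extensions, which are the inverses of reverse alternating
permutations. *)
Lemma zigzag_gen_split : zigzag_gen = \sum_(s | ralt s) chsum B (des_at s) N 0.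
Proof.
under eq_bigr => s _ do rewrite -chain_compat big_mkcond /=.
rewrite exchange_big /zigzag_gen big_mkcond /=; apply: eq_bigr => F _.
have [s0 h] := prec_perm F.
under [RHS]eq_bigr => s _ do rewrite (compat_eq s h).
rewrite -(ralt_zigzag h) -big_mkcondr /=.
case: (boolP (ralt s0)) => hs.
  by rewrite (big_pred1 s0) // => s /=; rewrite andb_idl // => /eqP ->.
by rewrite big_pred0 // => s; apply/negP => /andP[h1 /eqP e]; rewrite e (negbTE hs) in h1.
Qed.

Lemma zigzag_gen_Estar : eq_upto B (\prod_(1 <= i < N.+1) (1 - 'q ^+ i) * zigzag_gen) (Estar N).
Proof.
rewrite zigzag_gen_split mulr_sumr; apply: eq_upto_sum => s _.
by have := eq_upto_chsum (B := B) (des_at s) N 0; rewrite muln0 add0n -maj_des_at.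
Qed.

Lemma zigzag_gen_tEstar : eq_upto B zigzag_gen (tEstar N).
Proof.
rewrite /tEstar; set D := \prod_(_ <= _ < _) _.
have uD : D \is a GRing.unit.
  by rewrite /D big_nat_cond rpred_prod // => i /andP[/andP[i0 _] _]; apply: fps_unit_1subXn.
have -> : zigzag_gen = D * zigzag_gen / D by rewrite mulrAC divrr // mul1r.
apply: eq_uptoM => //; exact: zigzag_gen_Estar.
Qed.
End PPart.

(** * Reverse plane partitions of the staircase strip as walks *)

(** Since the number of intermediate states is odd, the last of them is an
outer tuple, like the first one. *)
Lemma walkP k p (kp : (k <= p.+1)%N) T (l : T.-tuple {ffun 'I_k -> 'I_p.+1}) :
  odd T ->
  reflect [/\ interlace (ground kp) (nth (ground kp) l 0), interlace (ground kp) (nth (ground kp) l T.-1)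
    & forall t, (t.+1 < T)%N ->
      if odd t then interlace (nth (ground kp) l t) (nth (ground kp) l t.+1)
      else interlace (nth (ground kp) l t.+1) (nth (ground kp) l t)]
    (walk kp (rcons l (ground kp))).
Proof.
move=> oT; have T0 : (0 < T)%N by case: (T) oT.
have nr t : (t < T)%N -> nth (ground kp) (rcons l (ground kp)) t = nth (ground kp) l t.
  by move=> tT; rewrite nth_rcons size_tuple tT.
have nT : nth (ground kp) (rcons l (ground kp)) T = ground kp.
  by rewrite nth_rcons size_tuple ltnn eqxx.
apply: (iffP (ipathP _ (ground kp) _ _ _))=> [|[h1 h2 h3]]; rewrite size_rcons size_tuple.
  move=> h; split.
  - by have := h 0%N isT; rewrite nr.
  - have := h T (ltnSn T); rewrite add0n nT /walk_rel oT.
    by rewrite -[X in nth _ (_ :: _) X](prednK T0) /= nr // prednK.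
  - move=> t tT; have := h t.+1 (ltnW tT); rewrite /walk_rel /= !nr ?(ltnW tT) //.
    by case: (odd t).
case=> [_|t]; first by rewrite /walk_rel /= nr.
rewrite ltnS leq_eqVlt => /orP[/eqP e|tT].
  have tT : (t < T)%N by rewrite -e.
  have et : T.-1 = t by rewrite -e.
  rewrite /= nr // {2}e nT /walk_rel add0n e oT -et.
  exact: h2.
by rewrite /walk_rel /= !nr ?(ltnW tT) //; have := h3 t tT; case: (odd t).
Qed.

Lemma interlaceE1 p (b a : {ffun 'I_1 -> 'I_p}) : interlace b a = (b ord0 <= a ord0)%N.
Proof.
apply/interlaceP/idP => [[h _]//|h]; split=> [r|r r' e]; first by rewrite [r]ord1.
by have := ltn_ord r'; rewrite -[nat_of_ord r']/(val r') e.
Qed.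

(** For k = 1 the determinant is a single entry, the strict half of
interlacing is void, and interlacing with the ground state says that values are
nonnegative. *)
Lemma zigzag_gen_mx m b :
  (Pmx 'q b ^+ m *m Qmx 'q b) ord0 ord0 = zigzag_gen m.*2 b.+1.
Proof.
have kp : (1 <= b.+1)%N by [].
have := det_zigzag_walk 'q kp m; rewrite det_mx11 mxE.
have -> : widen_ord kp 0 = ord0 by apply: val_inj.
move=> ->; set T := m.*2.+1.
(* States of walks with k = 1 are one-entry tuples. *)
pose f (F : {ffun 'I_T -> 'I_b.+1}) : T.-tuple {ffun 'I_1 -> 'I_b.+1} :=
  [tuple [ffun _ => F i] | i < T].
rewrite (reindex f); last first.
  apply/onW_bij/inj_card_bij; last by rewrite card_tuple !card_ffun !card_ord expn1.
  move=> F F' h; apply/ffunP => i.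
  have := congr1 (fun l : T.-tuple {ffun 'I_1 -> 'I_b.+1} => tnth l i ord0) h.
  by rewrite !tnth_mktuple !ffunE.
have fE F (i : 'I_T) : nth (ground kp) (f F) i = [ffun _ => F i] by rewrite nth_mktuple.
apply: eq_big => [F|F _].
  apply/walkP/forallP => [|[h1 h2 h3] i|h]; first by rewrite /= odd_double.
    apply/forallP => j; apply/implyP => /eqP ij.
    have := h3 i; rewrite -ij => /(_ (ltn_ord j)); rewrite !fE !interlaceE1 !ffunE.
    by case: (odd i).
  split.
  - by rewrite interlaceE1 ffunE.
  - by rewrite interlaceE1 ffunE.
  - move=> t tT; have := h (Ordinal (ltnW tT)).
    move/forallP/(_ (Ordinal tT))/implyP/(_ (eqxx _)) => /=.
    rewrite (fE F (Ordinal (ltnW tT))) (fE F (Ordinal tT)) !interlaceE1 !ffunE.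
    by case: (odd t).
congr ('q ^+ _); rewrite /walk_sum big_tuple; apply: eq_bigr => i _.
by rewrite tnth_mktuple /state_sum big_ord1 ffunE.
Qed.

Lemma nth_staircase M i : nth 0%N (staircase M) i = (M.-1 - i)%N.
Proof.
rewrite /staircase; case: (ltnP i M.-1) => h.
  by rewrite (nth_map 0%N) ?size_iota // nth_iota // add1n; lia.
by rewrite nth_default ?size_map ?size_iota //; lia.
Qed.

Lemma size_staircase M : size (staircase M) = M.-1.
Proof. by rewrite size_map size_iota. Qed.

Lemma head_staircase M : head 0%N (staircase M) = M.-1.
Proof. by rewrite -nth0 nth_staircase subn0. Qed.

Section Rpp.
Variables (n k b : nat).
Hypothesis n0 : (0 < n)%N.
Local Notation K := k.+1.
Local Notation la := (staircase (n + 2 * K)).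
Local Notation mu := (staircase n).
Local Notation T := (n + k.*2).*2.+1.
Hypothesis Kb : (K <= b.+1)%N.
Local Notation S := {ffun 'I_K -> 'I_b.+1}.
Local Notation cell := (skew la mu).
Local Notation id0 := (ground Kb).
Implicit Types (p : {ffun cell -> nat}) (c : cell) (l : T.-tuple S).

(** Counted from the bottom left corner of the strip. Even diagonals hold the
outer slices, those that meet the outer border. *)
Definition diagonal c : nat := (col_of c + (n + k.*2) - row_of c)%N.
(** The index in its slice: two successive antidiagonals i + j = constant,
one on the even and one on the odd diagonals, have the same level. *)
Definition level c : nat := (row_of c + col_of c - n.-1)./2.

Lemma cellP c : (n <= (row_of c + col_of c).+1)%N /\ (row_of c + col_of c < n + k.*2.+1)%N.
Proof.
case: c => -[i j] h; rewrite /row_of /col_of /=; move: (h).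
rewrite /in_skew !nth_staircase /= => /andP[]; lia.
Qed.

Lemma cell_exists i j : (n <= (i + j).+1)%N -> (i + j < n + k.*2.+1)%N ->
  exists c, row_of c = i /\ col_of c = j.
Proof.
move=> h1 h2.
have hi : (i < size la)%N by rewrite size_staircase; lia.
have hj : (j < head 0%N la)%N by rewrite head_staircase; lia.
have h : in_skew mu (Ordinal hi, Ordinal hj).
  by rewrite /in_skew !nth_staircase /=; lia.
by exists (exist _ (Ordinal hi, Ordinal hj) h).
Qed.

Lemma cell_inj c c' : row_of c = row_of c' -> col_of c = col_of c' -> c = c'.
Proof.
case: c => -[i j] h; case: c' => -[i' j'] h'; rewrite /row_of /col_of /= => e1 e2.
by apply: val_inj => /=; congr (_, _); apply: val_inj.
Qed.

(** On a given diagonal, i + j has a fixed parity, so that the level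
determines it. *)
Lemma slot_inj c c' : diagonal c = diagonal c' -> level c = level c' -> c = c'.
Proof.
rewrite /diagonal /level => e1 e2; have := cellP c; have := cellP c' => -[h1 h2] [h3 h4].
by apply: cell_inj; lia.
Qed.

Lemma diagonal_lt c : (diagonal c < T)%N.
Proof. by rewrite /diagonal; have [h1 h2] := cellP c; lia. Qed.
Lemma level_lt c : (level c < K)%N.
Proof. by rewrite /level; have [h1 h2] := cellP c; lia. Qed.

(** The entry at a given diagonal and level, or 0 where there is no cell. *)
Definition slot_val p (t r : nat) : nat := (\sum_(c | (diagonal c == t) && (level c == r)) p c)%N.

Lemma slot_val_cell p c : slot_val p (diagonal c) (level c) = p c.
Proof.
rewrite /slot_val (big_pred1 c) // => c' /=; apply/andP/eqP => [[/eqP e1 /eqP e2]|->].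
  exact: slot_inj.
by rewrite !eqxx.
Qed.

Lemma slot_val_none p t r : (forall c, diagonal c = t -> level c = r -> False) -> slot_val p t r = 0%N.
Proof.
by move=> h; rewrite /slot_val big_pred0 // => c; apply/negP => /andP[/eqP e1 /eqP e2]; apply: h e1 e2.
Qed.

Lemma cell_dec t r : (exists c, diagonal c = t /\ level c = r) \/
   (forall c, diagonal c = t -> level c = r -> False).
Proof.
case: (boolP [exists c : cell, (diagonal c == t) && (level c == r)]) => [/existsP[c]|/existsPn h].
  by move=> /andP[/eqP e1 /eqP e2]; left; exists c.
by right=> c e1 e2; have := h c; rewrite e1 e2 !eqxx.
Qed.

Lemma slot_val_mono p t r t' r' :
  (forall c, diagonal c = t -> level c = r ->
     exists c', [/\ diagonal c' = t', level c' = r' & (p c <= p c')%N]) ->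
  (slot_val p t r <= slot_val p t' r')%N.
Proof.
move=> h; case: (cell_dec t r) => [[c [e1 e2]]|/slot_val_none -> //].
by have [c' [<- <- le]] := h c e1 e2; rewrite -e1 -e2 !slot_val_cell.
Qed.

Lemma sum_slot_val p : (\sum_(t < T) \sum_(r < K) slot_val p t r = rpp_size p)%N.
Proof.
rewrite pair_big /= /rpp_size
  (partition_big (fun c => (Ordinal (diagonal_lt c), Ordinal (level_lt c))) xpredT) //=.
Qed.

(** In the coordinates diagonal and level, the right and lower neighbours of
a cell lie on the next and the previous diagonal; the level increases when the
cell is on an even diagonal. *)
Lemma right_even c : ~~ odd (diagonal c) -> ((level c).+1 < K)%N ->
  exists c', [/\ diagonal c' = (diagonal c).+1, level c' = (level c).+1,
                 row_of c' = row_of c & (col_of c' = (col_of c).+1)].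
Proof.
rewrite /diagonal /level => h1 h2; have [h3 h4] := cellP c.
have [||c' [e1 e2]] := @cell_exists (row_of c) (col_of c).+1; try lia.
by exists c'; rewrite e1 e2; split => //; lia.
Qed.

Lemma right_odd c : odd (diagonal c) ->
  exists c', [/\ diagonal c' = (diagonal c).+1, level c' = level c,
                 row_of c' = row_of c & (col_of c' = (col_of c).+1)].
Proof.
rewrite /diagonal /level => h1; have [h3 h4] := cellP c.
have [||c' [e1 e2]] := @cell_exists (row_of c) (col_of c).+1; try lia.
by exists c'; rewrite e1 e2; split => //; lia.
Qed.

Lemma down_even c : ~~ odd (diagonal c) -> ((level c).+1 < K)%N -> (0 < diagonal c)%N ->
  exists c', [/\ diagonal c' = (diagonal c).-1, level c' = (level c).+1,
                 row_of c' = (row_of c).+1 & (col_of c' = col_of c)].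
Proof.
rewrite /diagonal /level => h1 h2 h0; have [h3 h4] := cellP c.
have [||c' [e1 e2]] := @cell_exists (row_of c).+1 (col_of c); try lia.
by exists c'; rewrite e1 e2; split => //; lia.
Qed.

Lemma down_odd c : odd (diagonal c) ->
  exists c', [/\ diagonal c' = (diagonal c).-1, level c' = level c,
                 row_of c' = (row_of c).+1 & (col_of c' = col_of c)].
Proof.
rewrite /diagonal /level => h1; have [h3 h4] := cellP c.
have [||c' [e1 e2]] := @cell_exists (row_of c).+1 (col_of c); try lia.
by exists c'; rewrite e1 e2; split => //; lia.
Qed.

Lemma level_first c : diagonal c = 0%N -> level c = k.
Proof. by rewrite /diagonal /level; have [h3 h4] := cellP c; lia. Qed.

Lemma level_last c : diagonal c = (n + k.*2).*2 -> level c = k.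
Proof. by rewrite /diagonal /level; have [h3 h4] := cellP c; lia. Qed.

(** The shift by r makes each slice strictly increasing; where there is no
cell the value is r. *)
Definition walk_of_rpp p : T.-tuple S := [tuple [ffun r : 'I_K => inord (r + slot_val p t r)] | t < T].
Definition walk_val (l : seq S) (t r : nat) : nat := nth id0 l t (inord r).
Definition rpp_of_walk l : {ffun cell -> nat} := [ffun c => (walk_val l (diagonal c) (level c) - level c)%N].

Lemma slot_val_le p t r : (slot_val p t r <= rpp_size p)%N.
Proof.
rewrite /rpp_size (bigID (fun c => (diagonal c == t) && (level c == r))) /=; exact: leq_addr.
Qed.

Lemma walk_of_rppE p t (r : 'I_K) : (rpp_size p + k <= b)%N -> (t < T)%N ->
  nth id0 (walk_of_rpp p) t r = (r + slot_val p t r)%N :> nat.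
Proof.
move=> hb tT; rewrite /walk_of_rpp (nth_mktuple _ _ (Ordinal tT)) ffunE inordK //=.
by have := slot_val_le p t r; have := ltn_ord r; lia.
Qed.

(** Interlacing of consecutive slices is the comparison of neighbouring
entries. A missing entry counts as 0, and the missing slots form an order ideal
of the strip: the right and lower neighbours of a cell within the strip are
cells. On the first and
the last slice only the top level has a cell, which gives interlacing with the
ground state. *)
Lemma walk_of_rppP p : is_rpp p -> (rpp_size p + k <= b)%N -> walk Kb (rcons (walk_of_rpp p) id0).
Proof.
move=> [hrow hcol] hb; apply/walkP; first by rewrite /= odd_double.
have id0E (r : 'I_K) : id0 r = r :> nat by rewrite ffunE.
split.
- apply/interlaceP; split=> [r|r r' e]; rewrite id0E walk_of_rppE //; first exact: leq_addr.
  rewrite slot_val_none => [|c e1 e2]; first by rewrite addn0 -[nat_of_ord r']/(val r') e.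
  by have := level_first e1; rewrite e2; have := ltn_ord r'; rewrite -[nat_of_ord r']/(val r') e; lia.
- apply/interlaceP; split=> [r|r r' e]; rewrite id0E walk_of_rppE //; first exact: leq_addr.
  rewrite slot_val_none => [|c e1 e2]; first by rewrite addn0 -[nat_of_ord r']/(val r') e.
  by have := level_last e1; rewrite e2; have := ltn_ord r'; rewrite -[nat_of_ord r']/(val r') e; lia.
- move=> t tT; have tT' := ltnW tT; case: ifP => ot.
    apply/interlaceP; split=> [r|r r' e]; rewrite !walk_of_rppE //.
      rewrite leq_add2l; apply: slot_val_mono => c e1 e2.
      have [|c' [f1 f2 f3 f4]] := @right_odd c; first by rewrite e1.
      by exists c'; rewrite f1 f2 e1 e2; split=> //; apply: hrow; rewrite ?f3 ?f4.
    rewrite -[nat_of_ord r']/(val r') e addSn ltnS leq_add2l; apply: slot_val_mono => c e1 e2.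
    have [| | |c' [f1 f2 f3 f4]] := @down_even c; rewrite ?e1 ?e2 //=.
    - by rewrite ot.
    - by rewrite -e; apply: ltn_ord.
    - by exists c'; rewrite f1 f2 e1 e2; split=> //; apply: hcol; rewrite ?f3 ?f4.
  apply/interlaceP; split=> [r|r r' e]; rewrite !walk_of_rppE //.
    rewrite leq_add2l; apply: slot_val_mono => c e1 e2.
    have [|c' [f1 f2 f3 f4]] := @down_odd c; first by rewrite e1 /= ot.
    by exists c'; rewrite f1 f2 e1 e2; split=> //; apply: hcol; rewrite ?f3 ?f4.
  rewrite -[nat_of_ord r']/(val r') e addSn ltnS leq_add2l; apply: slot_val_mono => c e1 e2.
  have [| |c' [f1 f2 f3 f4]] := @right_even c; rewrite ?e1 ?e2 ?ot //=.
  - by rewrite -e; apply: ltn_ord.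
  - by exists c'; rewrite f1 f2 e1 e2; split=> //; apply: hrow; rewrite ?f3 ?f4.
Qed.

(** The sum of all shifts r, over all slots, with or without a cell. *)
Definition shift_sum : nat := (T * \sum_(r < K) r)%N.

Lemma walk_sum_of_rpp p : (rpp_size p + k <= b)%N -> walk_sum (walk_of_rpp p) = (shift_sum + rpp_size p)%N.
Proof.
move=> hb; rewrite /walk_sum big_tuple -sum_slot_val /shift_sum -[X in (X * _)%N]card_ord -sum_nat_const.
rewrite -big_split /=; apply: eq_bigr => t _; rewrite /state_sum -big_split /=.
by apply: eq_bigr => r _; rewrite (tnth_nth id0) walk_of_rppE.
Qed.

Lemma walk_of_rppK p : (rpp_size p + k <= b)%N -> rpp_of_walk (walk_of_rpp p) = p.
Proof.
move=> hb; apply/ffunP => c; rewrite ffunE /walk_val walk_of_rppE ?diagonal_lt // inordK ?level_lt //.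
by rewrite slot_val_cell addKn.
Qed.

Section Walk.
Variable l : T.-tuple S.
Hypothesis wl : walk Kb (rcons l id0).

Lemma walk_interlace :
  [/\ interlace id0 (nth id0 l 0), interlace id0 (nth id0 l T.-1)
    & forall t, (t.+1 < T)%N ->
      if odd t then interlace (nth id0 l t) (nth id0 l t.+1)
      else interlace (nth id0 l t.+1) (nth id0 l t)].
Proof. by apply/walkP => //=; rewrite odd_double. Qed.

Lemma interlace_inord (x y : S) : interlace x y ->
  (forall r, (r < K)%N -> (x (inord r) <= y (inord r))%N) /\
  (forall r, (r.+1 < K)%N -> (y (inord r) < x (inord r.+1))%N).
Proof.
move=> /interlaceP[h1 h2]; split=> r hr; first exact: h1.
by apply: h2; rewrite /= !inordK ?(ltnW hr).
Qed.

Lemma walk_val_first r : (r.+1 < K)%N -> (walk_val l 0 r <= r)%N.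
Proof.
move=> hr; have [/interlace_inord[_ /(_ r hr) h] _ _] := walk_interlace.
by move: h; rewrite ffunE /= inordK // ltnS.
Qed.

Lemma walk_val_last r : (r.+1 < K)%N -> (walk_val l T.-1 r <= r)%N.
Proof.
move=> hr; have [_ /interlace_inord[_ /(_ r hr) h] _] := walk_interlace.
by move: h; rewrite ffunE /= inordK // ltnS.
Qed.

Lemma walk_val_even t r : (t.+1 < T)%N -> ~~ odd t -> (r < K)%N -> (walk_val l t.+1 r <= walk_val l t r)%N.
Proof.
move=> tT ot hr; have [_ _ /(_ t tT)] := walk_interlace; rewrite (negbTE ot).
by move=> /interlace_inord[h _]; apply: h.
Qed.

Lemma walk_val_evenS t r : (t.+1 < T)%N -> ~~ odd t -> (r.+1 < K)%N ->
  (walk_val l t r < walk_val l t.+1 r.+1)%N.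
Proof.
move=> tT ot hr; have [_ _ /(_ t tT)] := walk_interlace; rewrite (negbTE ot).
by move=> /interlace_inord[_ h]; apply: h.
Qed.

Lemma walk_val_odd t r : (t.+1 < T)%N -> odd t -> (r < K)%N -> (walk_val l t r <= walk_val l t.+1 r)%N.
Proof.
by move=> tT ot hr; have [_ _ /(_ t tT)] := walk_interlace; rewrite ot => /interlace_inord[h _]; apply: h.
Qed.

Lemma walk_val_oddS t r : (t.+1 < T)%N -> odd t -> (r.+1 < K)%N ->
  (walk_val l t.+1 r < walk_val l t r.+1)%N.
Proof.
by move=> tT ot hr; have [_ _ /(_ t tT)] := walk_interlace; rewrite ot => /interlace_inord[_ h]; apply: h.
Qed.

Lemma walk_val_strict t : (t < T)%N -> strict (nth id0 l t).
Proof.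
move=> tT; have [h0 _ h] := walk_interlace.
case: t tT => [_|t tT]; first exact: interlace_strict_out h0.
by move: (h t tT); case: (odd t) => hi; [exact: interlace_strict_out hi | exact: interlace_strict_in hi].
Qed.

Lemma walk_val_ge t r : (t < T)%N -> (r < K)%N -> (r <= walk_val l t r)%N.
Proof. by move=> tT hr; have := strict_ge (walk_val_strict tT) (inord r); rewrite inordK. Qed.

(** The ground state leaves only the top level of the first slice free, and
each pair of steps frees one more level: by interlacing, the value at a lower
level stays squeezed at its minimum r. *)
Lemma walk_val_forced_left t r : (t < T)%N -> (r + t./2 < k)%N -> (walk_val l t r <= r)%N.
Proof.
elim: t r => [|t IH] r tT hr; first by apply: walk_val_first; lia.
case: (boolP (odd t)) => ot.
  have h1 := @walk_val_oddS t r tT ot; have h2 := IH r.+1 (ltnW tT).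
  have h3 : (r.+1 < K)%N by lia.
  have h4 : (r.+1 + t./2 < k)%N by lia.
  by move: (h1 h3) (h2 h4); lia.
apply: leq_trans (walk_val_even tT ot _) (IH r (ltnW tT) _); lia.
Qed.

(** The same argument from the other end, u being the distance to the last
slice. *)
Lemma walk_val_forced_right u r : (u < T)%N -> (r + u./2 < k)%N -> (walk_val l (T.-1 - u) r <= r)%N.
Proof.
elim: u r => [|u IH] r uT hr; first by rewrite subn0; apply: walk_val_last; lia.
set t := (T.-1 - u.+1)%N.
have et : (T.-1 - u)%N = t.+1 by rewrite /t; lia.
have tT : (t.+1 < T)%N by rewrite /t; lia.
case: (boolP (odd u)) => ou.
  have ot : ~~ odd t by rewrite /t; lia.
  have h1 := @walk_val_evenS t r tT ot; have h2 := IH r.+1 (ltnW uT); rewrite et in h2.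
  have h3 : (r.+1 < K)%N by lia.
  have h4 : (r.+1 + u./2 < k)%N by lia.
  by move: (h1 h3) (h2 h4); lia.
have ot : odd t by rewrite /t; lia.
have h2 := IH r (ltnW uT); rewrite et in h2.
by apply: leq_trans (walk_val_odd tT ot _) (h2 _); lia.
Qed.

(** A slot without a cell would have its column or its row before the first
one; these are the triangles missing at the two ends. *)
Lemma no_cell_near_end t r : (t < T)%N -> (r < K)%N -> (forall c, diagonal c = t -> level c = r -> False) ->
  (r + t./2 < k)%N \/ (r + (T.-1 - t)./2 < k)%N.
Proof.
move=> tT hr h; case: (ltnP (r + t./2) k) => h1; first by left.
case: (ltnP (r + (T.-1 - t)./2) k) => h2; first by right.
(* The row and the column of the slot, obtained by solving the equations
   for diagonal and level. *)
have [||c [e1 e2]] := @cell_exists (r + n + k - (t./2 + odd t)) (r + t./2 - k); try lia.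
by case: (h c); rewrite /diagonal /level e1 e2; lia.
Qed.

(** Where there is no cell, the forced value r is the one that [walk_of_rpp]
assigns; so the two translations are inverse to each other. *)
Lemma slot_val_rpp_of_walk t r : (t < T)%N -> (r < K)%N ->
  (r + slot_val (rpp_of_walk l) t r)%N = walk_val l t r.
Proof.
move=> tT hr; have := walk_val_ge tT hr; case: (cell_dec t r) => [[c [<- <-]]|h] ge.
  by rewrite slot_val_cell ffunE subnKC.
rewrite slot_val_none // addn0; apply/eqP; rewrite eqn_leq ge /=.
case: (no_cell_near_end tT hr h) => h'; first exact: walk_val_forced_left.
have := @walk_val_forced_right (T.-1 - t) r; rewrite subKn; last by rewrite -ltnS.
by apply=> //; lia.
Qed.

Lemma walk_sum_rpp_of_walk : walk_sum l = (shift_sum + rpp_size (rpp_of_walk l))%N.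
Proof.
rewrite /walk_sum big_tuple -sum_slot_val /shift_sum -[X in (X * _)%N]card_ord -sum_nat_const.
rewrite -big_split /=; apply: eq_bigr => t _; rewrite /state_sum -big_split /=.
by apply: eq_bigr => r _; rewrite slot_val_rpp_of_walk // (tnth_nth id0) /walk_val inord_val.
Qed.

Lemma rpp_of_walk_right c c' : row_of c' = row_of c -> col_of c' = (col_of c).+1 ->
  (rpp_of_walk l c <= rpp_of_walk l c')%N.
Proof.
move=> e1 e2; rewrite !ffunE.
have h1 := cellP c; have h2 := cellP c'; have h3 := diagonal_lt c'; have h4 := level_lt c'.
have h5 : diagonal c' = (diagonal c).+1 by rewrite /diagonal; lia.
case: (boolP (odd (diagonal c))) => ot.
  have h6 : level c' = level c by move: ot; rewrite /diagonal /level; lia.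
  by rewrite h5 h6 leq_sub2r // walk_val_odd // -?h5 -?h6.
have h6 : level c' = (level c).+1 by move: ot; rewrite /diagonal /level; lia.
by have := @walk_val_evenS (diagonal c) (level c); rewrite -h5 -h6 => /(_ h3 ot h4); rewrite h6; lia.
Qed.

Lemma rpp_of_walk_down c c' : row_of c' = (row_of c).+1 -> col_of c' = col_of c ->
  (rpp_of_walk l c <= rpp_of_walk l c')%N.
Proof.
move=> e1 e2; rewrite !ffunE.
have h1 := cellP c; have h2 := cellP c'; have h3 := diagonal_lt c; have h4 := level_lt c'.
have h5 : diagonal c = (diagonal c').+1 by rewrite /diagonal; lia.
case: (boolP (odd (diagonal c'))) => ot.
  have h6 : level c' = (level c).+1 by move: ot; rewrite /diagonal /level; lia.
  by have := @walk_val_oddS (diagonal c') (level c); rewrite -h5 -h6 => /(_ h3 ot h4); rewrite h6; lia.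
have h6 : level c' = level c by move: ot; rewrite /diagonal /level; lia.
by rewrite h5 h6 leq_sub2r // walk_val_even // -?h5 -?h6.
Qed.

(** Comparison of neighbours extends to a whole row or column, because the
cells of a row or of a column of the strip are consecutive. *)
Lemma rpp_of_walkP : is_rpp (rpp_of_walk l).
Proof.
have row m : forall c d, row_of c = row_of d -> (col_of d - col_of c = m)%N ->
    (col_of c <= col_of d)%N -> (rpp_of_walk l c <= rpp_of_walk l d)%N.
  elim: m => [|m IH] c d e1 e2 le.
    by rewrite (@cell_inj c d) //; lia.
  have h1 := cellP c; have h2 := cellP d.
  have [||c' [f1 f2]] := @cell_exists (row_of c) (col_of c).+1; try lia.
  by apply: leq_trans (rpp_of_walk_right f1 f2) (IH _ _ _ _ _); lia.
have col m : forall c d, col_of c = col_of d -> (row_of d - row_of c = m)%N ->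
    (row_of c <= row_of d)%N -> (rpp_of_walk l c <= rpp_of_walk l d)%N.
  elim: m => [|m IH] c d e1 e2 le.
    by rewrite (@cell_inj c d) //; lia.
  have h1 := cellP c; have h2 := cellP d.
  have [||c' [f1 f2]] := @cell_exists (row_of c).+1 (col_of c); try lia.
  by apply: leq_trans (rpp_of_walk_down f1 f2) (IH _ _ _ _ _); lia.
by split=> c d e le; [apply: row e erefl le | apply: col e erefl le].
Qed.

End Walk.

Lemma rpp_of_walk_inj (l l' : T.-tuple S) : walk Kb (rcons l id0) -> walk Kb (rcons l' id0) ->
  rpp_of_walk l = rpp_of_walk l' -> l = l'.
Proof.
move=> w w' e; apply: eq_from_tnth => t; apply/ffunP => r; apply: val_inj => /=.
have := slot_val_rpp_of_walk w (ltn_ord t) (ltn_ord r);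
  rewrite e (slot_val_rpp_of_walk w' (ltn_ord t) (ltn_ord r)).
by rewrite /walk_val inord_val -!tnth_nth.
Qed.

(** The translations are mutually inverse between reverse plane partitions of
size d and bounded walks of weight d plus the total shift; the bound on walks is harmless,
as no entry exceeds d. *)
Lemma card_rpp d : (d + k <= b)%N ->
  fcoef (fps_gen (@RPP la mu) (@rpp_size la mu)) d =
  #|[pred l : T.-tuple S | walk Kb (rcons l id0) && (walk_sum l == shift_sum + d)%N]|%:R.
Proof.
move=> hd; rewrite /fps_gen /=; congr (_%:R); set A := [pred l | _].
set X := fset_set _.
have hX p : (p \in X) = `[< is_rpp p /\ rpp_size p = d >].
  rewrite /X in_fset_set; last exact: finite_RPP_size.
  by apply/idP/asboolP; rewrite inE.
pose s := [seq rpp_of_walk l | l <- enum A].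
have us : uniq s.
  rewrite map_inj_in_uniq ?enum_uniq // => l l'; rewrite !mem_enum !inE.
  by move=> /andP[w _] /andP[w' _]; apply: rpp_of_walk_inj.
have -> : #|` X| = size s.
  apply: perm_size; apply: uniq_perm => // p; rewrite hX.
  apply/asboolP/mapP => [[h1 h2]|[l]].
    have hb : (rpp_size p + k <= b)%N by rewrite h2.
    exists (walk_of_rpp p); last by rewrite walk_of_rppK.
    by rewrite mem_enum inE walk_of_rppP //= walk_sum_of_rpp // h2.
  rewrite mem_enum inE => /andP[w /eqP e] ->; split; first exact: rpp_of_walkP.
  by move: e; rewrite walk_sum_rpp_of_walk // => /addnI.
by rewrite size_map -cardE.
Qed.

End Rpp.

(** * The determinant formula *)

(** At each end of the strip, for every i < k+1, two diagonals miss exactly the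
levels below i, whose shifts add up to i (i - 1) on the two diagonals together.
So the slots without a cell account for the power of q in [det_hankel], and the
first summand is the total shift over the cells. *)
Lemma shift_sumE n k :
  shift_sum n k = (k.+1 * (k.+1 - 1) * (6 * n + 8 * k.+1 - 1) %/ 6 + (\sum_(i < k.+1) i * (i - 1)).*2)%N.
Proof.
have h1 : ((\sum_(r < k.+1) r) * 2 = k.+1 * k)%N.
  elim: (k) => [|j IH]; first by rewrite big_ord1.
  by rewrite big_ord_recr /= mulnDl IH; lia.
have h2 : ((\sum_(i < k.+1) i * (i - 1)) * 3 = k.+1 * k * (k - 1))%N.
  elim: (k) => [|j IH]; first by rewrite big_ord1.
  rewrite big_ord_recr /= mulnDl IH; case: (j) => // j'; rewrite !subn1 /=; lia.
have h3 := divnK (dvdn_exponent n k.+1); rewrite subn1 /= in h3.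
rewrite /shift_sum subn1 /=; set e := (_ %/ 6)%N in h3 *.
set s1 := (\sum_(r < _) _)%N in h1 *; set s2 := (\sum_(r < _) _)%N in h2 *.
apply/eqP; rewrite -(eqn_pmul2r (_ : 0 < 6)%N) // mulnDl h3.
have -> : (s2.*2 * 6 = 4 * (s2 * 3))%N by lia.
have -> : ((n + k.*2).*2.+1 * s1 * 6 = (n + k.*2).*2.+1 * 3 * (s1 * 2))%N by lia.
rewrite h1 h2; case: (k) => [|j]; first by rewrite !(muln0, mul0n, mul1n).
by rewrite subn1 /=; apply/eqP; nia.
Qed.

Lemma shift_sum_le n k b (Kb : (k.+1 <= b.+1)%N)
    (l : ((n + k.*2).*2.+1).-tuple {ffun 'I_k.+1 -> 'I_b.+1}) :
  (0 < n)%N -> walk Kb (rcons l (ground Kb)) -> (shift_sum n k <= walk_sum l)%N.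
Proof. by move=> n0 w; rewrite (walk_sum_rpp_of_walk n0 w) leq_addr. Qed.

Theorem mainTheorem1 (n k : nat) (hn : (0 < n)%N) (hk : (0 < k)%N) :
  'q ^+ (k * (k - 1) * (6 * n + 8 * k - 1) %/ 6)%N *
    fps_gen (@RPP (staircase (n + 2 * k)) (staircase n))
            (@rpp_size (staircase (n + 2 * k)) (staircase n))
  = \det (\matrix_(i < k, j < k) tEstar (2 * (n + i.+1 + j.+1) - 3)%N).
Proof.
case: k hk => // k _; apply: fpsP => D.
set e := (_ %/ 6)%N; pose c := (\sum_(i < k.+1) i * (i - 1)).*2.
have she : shift_sum n k = (e + c)%N := shift_sumE n k.
pose b := (D + k)%N; have Kb : (k.+1 <= b.+1)%N by rewrite ltnS leq_addl.
have -> : fcoef (\det (\matrix_(i < k.+1, j < k.+1) tEstar (2 * (n + i.+1 + j.+1) - 3)%N)) D =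
    fcoef (\det (\matrix_(i < k.+1, j < k.+1)
       (Pmx 'q b ^+ (n + i + j) *m Qmx 'q b) ord0 ord0)) D.
  apply: (@eq_upto_det b.+1); last by rewrite ltnS leq_addr.
  move=> i j; rewrite [X in eq_upto _ X _]mxE [X in eq_upto _ _ X]mxE zigzag_gen_mx.
  have -> : (2 * (n + i.+1 + j.+1) - 3 = (n + i + j).*2.+1)%N by lia.
  by apply/eq_upto_sym/zigzag_gen_tEstar; rewrite odd_double.
set M := \det _.
(* The factor q^c of det_hankel is supplied by shifting the coefficient. *)
have -> : fcoef M D = fcoef ('q ^+ c * M) (D + c) by rewrite fcoef_qXM leq_addl addnK.
rewrite /M /c -(det_hankel 'q (Kb : k.+1 <= b.+1)%N) det_zigzag_walk -/c.
set A := walk Kb; rewrite fcoef_sum.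
have -> : \sum_(l : ((n + k.*2).*2.+1).-tuple {ffun 'I_k.+1 -> 'I_b.+1} | A (rcons l (ground Kb)))
     fcoef ('q ^+ walk_sum l) (D + c) =
   #|[pred l : ((n + k.*2).*2.+1).-tuple {ffun 'I_k.+1 -> 'I_b.+1} |
     A (rcons l (ground Kb)) && (walk_sum l == D + c)%N]|%:R.
  rewrite -sum1_card natr_sum big_mkcondr /=; apply: eq_bigr => l _.
  by rewrite coef_fpsXn eq_sym; case: eqP.
rewrite fcoef_qXM; case: leqP => eD.
  rewrite (card_rpp hn Kb); last by rewrite /b leq_add2r leq_subr.
  by congr (_%:R); apply: eq_card => l; rewrite !inE she; congr (_ && (_ == _)); lia.
(* Below the exponent of q there is no walk: its weight would be less than
   the total shift. *)
rewrite eq_card0 // => l; rewrite !inE; apply/negP => /andP[w /eqP wl].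
by have := shift_sum_le hn w; rewrite wl she; lia.
Qed.
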